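(* Take any integer $d\ge 2$. Let $X_1,X_2,\ldots$ be i.i.d. random vectors in $\mathbb{R}^d$ with some probability density in $\mathcal{P}(d)$ or $\mathcal{P}^+(d)$. Let $L_n$ be the length of the optimal traveling salesman tour through $X_1,\ldots,X_n$, and, for $n$ even, let $M_n$ be the length of the minimal matching of $X_1,\ldots,X_n$. Then $L_n$ has fluctuations of order at least $n^{(d-2)/2d}$ as $n\to\infty$, and $M_n$ has fluctuations of order at least $n^{(d-2)/2d}$ as $n\to\infty$ through the even integers. Here $n^{(d-2)/2d}$ means $n^{(d-2)/(2d)}$.
   Context: Fluctuations: for a sequence of random variables $\{X_n\}$ and a sequence of positive real numbers $\{\delta_n\}$, we say that $X_n$ has fluctuations of order at least $\delta_n$ if there are positive constants $c_1,c_2$ such that for all large $n$, and for all $-\infty<a\le b<\infty$ with $b-a\le c_1\delta_n$, $\mathbb{P}(a\le X_n\le b)\le 1-c_2$ (for a sequence indexed by even $n$, ''for all large $n$'' means for all large even $n$). Class $\mathcal{P}(d)$: the set of all probability densities of the form $e^{-V}$ on $\mathbb{R}^d$, where $V$ is a $C^\infty$ function, $V$ and all its derivatives have at most polynomial growth at infinity, and $e^{V}$ increases faster than any polynomial at infinity. Class $\mathcal{P}^+(d)$: the set of all probability densities of the form $e^{-V}$ on $[0,\infty)^d$, such that $V$ is a $C^\infty$ function in $(0,\infty)^d$, $V$ and all its derivatives have at most polynomial growth at infinity and extend continuously to the boundary of $[0,\infty)^d$, and $e^{V}$ increases faster than any polynomial at infinity. The length of the optimal traveling salesman tour through $x_1,\ldots,x_n\in\mathbb{R}^d$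 is the minimum over permutations $\pi$ of $\{1,\ldots,n\}$ of $\sum_{i=1}^{n}\|x_{\pi(i)}-x_{\pi(i+1)}\|$, with $\pi(n+1):=\pi(1)$ and $\|\cdot\|$ the Euclidean norm. For $n$ even, the length of the minimal matching is the minimum, over all partitions of $\{1,\ldots,n\}$ into $n/2$ pairs, of the sum of $\|x_i-x_j\|$ over the pairs $\{i,j\}$ of the partition. *)

(* Defs.v *)
From HB Require Import structures.
From mathcomp Require Import all_boot all_order all_algebra perm.
From mathcomp Require Import zify.
From mathcomp Require Import all_classical all_reals all_analysis.

Set Implicit Arguments.
Unset Strict Implicit.
Unset Printing Implicit Defensive.

Import Order.TTheory GRing.Theory Num.Theory.
Import numFieldNormedType.Exports.

Local Open Scope classical_set_scope.
Local Open Scope ring_scope.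

(* As a measurable space, R^d is the library's d.-tuple R with its product
   sigma-algebra; as a normed space, it is 'rV[R]_d. *)
Definition row_of_tuple (R : realType) (d : nat) (t : d.-tuple R) : 'rV[R]_d :=
  \row_i tnth t i.

Definition cons_pair (R : realType) (d : nat) (z : d.-tuple R * R) :
    d.+1.-tuple R :=
  [tuple of z.2 :: z.1].

Lemma measurable_cons_pair (R : realType) (d : nat) :
  measurable_fun setT (@cons_pair R d).
Proof. exact: measurable_cons measurable_snd measurable_fst. Qed.

Fixpoint lebesgue_tuple (R : realType) (d : nat) :
    set (d.-tuple R) -> \bar R :=
  match d with
  | 0 => \d_([tuple] : 0.-tuple R)
  | d'.+1 => pushforward (@lebesgue_tuple R d' \x lebesgue_measure)%E
                         (@cons_pair R d')
  end.
Arguments lebesgue_tuple R d : clear implicits.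

Section lebesgue_tuple_measure.
Variables (R : realType) (d : nat).

Let lebesgue_tuple_measureP :
  exists m : {measure set (d.-tuple R) -> \bar R}, lebesgue_tuple R d = m.
Proof.
elim: d => [|n [m mE]]; first by exists (\d_([tuple] : 0.-tuple R)).
exists (pushforward (m \x lebesgue_measure)%E (@cons_pair R n)).
  by rewrite /= mE.
Unshelve. exact: measurable_cons_pair.
Qed.

Let lebesgue_tuple0 : lebesgue_tuple R d set0 = 0%E.
Proof. by have [m ->] := lebesgue_tuple_measureP; exact: measure0. Qed.

Let lebesgue_tuple_ge0 A : (0 <= lebesgue_tuple R d A)%E.
Proof. by have [m ->] := lebesgue_tuple_measureP. Qed.

Let lebesgue_tuple_sigma_additive : semi_sigma_additive (lebesgue_tuple R d).
Proof.
have [m ->] := lebesgue_tuple_measureP; exact: measure_semi_sigma_additive.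
Qed.

HB.instance Definition _ := isMeasure.Build _ _ _ (lebesgue_tuple R d)
  lebesgue_tuple0 lebesgue_tuple_ge0 lebesgue_tuple_sigma_additive.

End lebesgue_tuple_measure.

Lemma lebesgue_tuple_box (R : realType) (d : nat) (A : 'I_d -> set R) :
  (forall i, measurable (A i)) ->
  lebesgue_tuple R d [set t | forall i, A i (tnth t i)] =
  (\prod_i lebesgue_measure (A i))%E.
Proof.
elim: d A => [|d IH] A mA.
  rewrite big_ord0 /= diracE mem_set//=; by case.
pose B : set (d.-tuple R) := [set t | forall i, A (lift ord0 i) (tnth t i)].
have mB : measurable B.
  rewrite (_ : B = \bigcap_(i in [set: 'I_d])
      (@tnth d R ^~ i @^-1` A (lift ord0 i))).
    apply: fin_bigcap_measurable => // i _; rewrite -[_ @^-1` _]setTI.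
    by apply: measurable_tnth => //; exact: mA.
  by apply/seteqP; split=> t At i; [move=> _; exact: At|exact: At].
transitivity ((lebesgue_tuple R d \x lebesgue_measure)%E (B `*` A ord0)).
  rewrite /= /pushforward; congr (_ _); apply/seteqP; split=> -[t r] /=.
    move=> Atr; split=> [i|]; last exact: (Atr ord0).
    by have := Atr (lift ord0 i); rewrite tnthS /=.
  move=> [Bt Ar] i; case: (unliftP ord0 i) => [j|] ->; last by [].
  by rewrite tnthS; exact: Bt.
rewrite product_measure1E//=; last exact: mA.
rewrite big_ord_recl muleC; congr (_ * _)%E.
by rewrite -IH.
Qed.

Definition mutually_independent (R : realType) (disp disp' : measure_display)
    (T : measurableType disp) (T' : measurableType disp')
    (P : probability T R) (X : nat -> {RV P >-> T'}) : Prop :=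
  forall (s : seq nat) (A : nat -> set T'), uniq s ->
    (forall i, measurable (A i)) ->
    P (\bigcap_(i in [set` s]) (X i @^-1` A i)) =
    (\prod_(i <- s) P (X i @^-1` A i))%E.

Definition has_density (R : realType) (disp : measure_display)
    (T : measurableType disp) (P : probability T R) (d : nat)
    (X : {RV P >-> d.-tuple R}) (p : 'rV[R]_d -> R) : Prop :=
  forall A : set (d.-tuple R), measurable A ->
    distribution P X A =
    (\int[lebesgue_tuple R d]_(t in A) (p (row_of_tuple t))%:E)%E.

Definition fluctuations_at_least (R : realType) (disp : measure_display)
    (T : measurableType disp) (P : probability T R) (I : pred nat)
    (Y : nat -> T -> R) (delta : nat -> R) : Prop :=
  exists c1 c2 : R, [/\ 0 < c1, 0 < c2 &
    \forall n \near \oo, I n -> forall a b : R, a <= b -> b - a <= c1 * delta n ->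
      (P [set w | (a <= Y n w <= b)%R] <= (1 - c2)%:E)%E].

Section density_classes.
Variables (R : realType) (d : nat).
Implicit Types (U : set 'rV[R]_d) (f V p : 'rV[R]_d -> R) (s : seq 'I_d).

Definition enorm (x : 'rV[R]_d) : R := Num.sqrt (\sum_i x 0 i ^+ 2).

Definition partial (i : 'I_d) f : 'rV[R]_d -> R :=
  fun x => 'D_(delta_mx 0 i) f x.

Definition partials s f : 'rV[R]_d -> R := foldr partial f s.

Definition smooth_on U f : Prop :=
  forall s x, U x ->
    {for x, continuous (partials s f)} /\
    forall i, derivable (partials s f) x (delta_mx 0 i).

Definition poly_growth_on U f : Prop :=
  exists (k : nat) (C M : R), forall x, U x -> M <= enorm x ->
    `|f x| <= C * enorm x ^+ k.

Definition superpoly_growth_on U f : Prop :=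
  forall (k : nat) (C : R), exists M : R, forall x, U x -> M <= enorm x ->
    C * enorm x ^+ k <= f x.

Definition pos_orthant : set 'rV[R]_d := [set x | forall i, 0 < x 0 i].

Definition nonneg_orthant : set 'rV[R]_d := [set x | forall i, 0 <= x 0 i].

Definition extends_to_boundary f : Prop :=
  exists2 g : 'rV[R]_d -> R, {within nonneg_orthant, continuous g} &
    forall x, pos_orthant x -> g x = f x.

Definition probability_density p : Prop :=
  [/\ measurable_fun setT (p \o @row_of_tuple R d),
      forall x, 0 <= p x &
      (\int[lebesgue_tuple R d]_t (p (row_of_tuple t))%:E = 1)%E].

Definition class_P p : Prop :=
  probability_density p /\
  exists V : 'rV[R]_d -> R,
    [/\ forall x, p x = expR (- V x),
        smooth_on setT V,
        forall s, poly_growth_on setT (partials s V) &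
        superpoly_growth_on setT (fun x => expR (V x))].

(* V is taken to be its own continuous extension on the boundary; the
   differential conditions only involve its values on the open orthant. *)
Definition class_Pplus p : Prop :=
  probability_density p /\
  exists V : 'rV[R]_d -> R,
    [/\ forall x, nonneg_orthant x -> p x = expR (- V x),
        forall x, ~ nonneg_orthant x -> p x = 0,
        smooth_on pos_orthant V /\ {within nonneg_orthant, continuous V},
        forall s, poly_growth_on pos_orthant (partials s V) /\
                  extends_to_boundary (partials s V) &
        superpoly_growth_on pos_orthant (fun x => expR (V x))].

End density_classes.

Section tsp_matching.
Variables (R : realType) (d n : nat).
Implicit Types (x : 'I_n -> 'rV[R]_d) (P : {set {set 'I_n}}).

(* ordS is the cyclic successor on 'I_n *)
Definition tour_length x (pi : 'S_n) : R :=
  \sum_i enorm (x (pi i) - x (pi (ordS i))).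

Definition tsp_length x : R :=
  \big[Num.min/tour_length x 1%g]_(pi : 'S_n) tour_length x pi.

Definition perfect_matching P : bool :=
  finset.partition P [set: 'I_n]%SET && [forall B in P, #|B| == 2].

Definition matching_length x P : R :=
  \sum_(i < n) \sum_(j < n | (i < j)%N && ([set i; j]%SET \in P)) enorm (x i - x j).

(* an infimum over a finite set, nonempty when n is even; see
   min_matching_lengthP *)
Definition min_matching_length x : R :=
  inf [set matching_length x P | P in [set P | perfect_matching P]].

Lemma tsp_lengthP x :
  (exists pi, tsp_length x = tour_length x pi) /\
  forall pi, tsp_length x <= tour_length x pi.
Proof.
split; last by move=> pi; exact: bigmin_le.
rewrite /tsp_length; elim/big_ind: _ => [|a b [pa ->] [pb ->]|pi _].
- by exists 1%g.
- by rewrite minEle; case: ifP => _; [exists pa|exists pb].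
- by exists pi.
Qed.

Lemma exists_perfect_matching : ~~ odd n -> exists P, perfect_matching P.
Proof.
move=> en; exists (preim_partition (fun i : 'I_n => i./2) [set: 'I_n]%SET).
apply/andP; split; first exact: preim_partitionP.
apply/forallP => B; apply/implyP => /imsetP[i _ ->{B}].
have jn : ((if odd i then i.-1 else i.+1) < n)%N.
  by have := ltn_ord i; case: ifP => oi; lia.
have -> : [set y in [set: 'I_n] | i./2 == y./2]%SET = [set i; Ordinal jn]%SET.
  apply/setP => y; rewrite !inE -!val_eqE /=.
  by case: ifP => oi; lia.
by rewrite cards2 -val_eqE /=; case: ifP => oi; lia.
Qed.

Lemma min_matching_lengthP x : ~~ odd n ->
  (exists2 P, perfect_matching P & min_matching_length x = matching_length x P) /\
  forall P, perfect_matching P -> min_matching_length x <= matching_length x P.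
Proof.
move=> /exists_perfect_matching[P0 mP0].
pose Q := [arg min_(P < P0 | perfect_matching P) matching_length x P]%O.
have [mQ leQ] : perfect_matching Q /\
    forall P, perfect_matching P -> matching_length x Q <= matching_length x P.
  by rewrite /Q; case: arg_minP => // P mP leP; split.
suff -> : min_matching_length x = matching_length x Q by split=> //; exists Q.
apply/eqP; rewrite eq_le; apply/andP; split.
  apply: ge_inf; last by exists Q.
  by exists (matching_length x Q) => _ [P mP <-]; exact: leQ.
apply: lb_le_inf; first by exists (matching_length x Q), Q.
by move=> _ [P mP <-]; exact: leQ.
Qed.

End tsp_matching.

(* Main.v *)
From HB Require Import structures.
Require Import Defs.
From mathcomp Require Import all_boot all_order all_algebra perm.
From mathcomp Require Import all_classical all_reals all_analysis measurable_realfun.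
From mathcomp Require Import ring lra zify.
Import Order.TTheory GRing.Theory Num.Theory.
Import numFieldNormedType.Exports.
Local Open Scope classical_set_scope.
Local Open Scope ring_scope.
Set Implicit Arguments.
Unset Strict Implicit.
Unset Printing Implicit Defensive.

(** Write F for either functional and delta_n = n^((d-2)/(2d)).  The proof
    compares the sample with a dilated copy of itself.

    F is homogeneous of degree one: multiplying all points by 1/t multiplies F
    by 1/t.  Take t = 1 - alpha / sqrt n.  Since the density is bounded, two
    given points are at distance less than r with probability O(r^d), so for
    r = kappa n^(-1/d) a typical sample has at least n/2 points with no
    neighbour at distance less than r, and such points force F to be at least
    of order n r = kappa n^(1 - 1/d) (small_spread_probability).  The dilation
    therefore moves F by at least a multiple of
    alpha n^(1 - 1/d - 1/2) = alpha delta_n.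

    On the other hand the dilation is hard to detect from n independent
    points.  If f is the square root of the density and g(x) = t^(d/2) f(t x)
    the square root of the density of the dilated points, then the integral of
    (g - f)^2 is O((1 - t)^2) = O(alpha^2 / n), because f is Lipschitz along
    dilations with a rapidly decaying constant (half_root_dilation_lipschitz,
    potential_regular_root).  Hence the affinity of the two densities, the
    integral of f g, is 1 - O(alpha^2 / n), and its n-th power stays close to 1
    (bernoulli_ineq) when alpha is small.

    Suppose now that F lies in an interval shorter than c1 delta_n with
    probability more than 15/16.  The dilated value of F leaves that interval
    as soon as F had its typical size, so it stays in it with probability at
    most 1/8.  The event that F lies in the interval would then separate the two
    laws on n-tuples, which affinity_tensor excludes
    (spread_anticoncentration). *)

(** * Independent samples as random tuples *)

Section boxes.
Context {disp} {T : measurableType disp}.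

Definition box n (A : 'I_n -> set T) : set (n.-tuple T) :=
  [set t | forall i, A i (tnth t i)].

Definition boxes n : set (set (n.-tuple T)) :=
  [set box A | A in [set A : 'I_n -> set T | forall i, measurable (A i)]].

Lemma measurable_box n (A : 'I_n -> set T) :
  (forall i, measurable (A i)) -> measurable (box A).
Proof.
move=> mA; rewrite (_ : box A = \bigcap_(i in [set: 'I_n])
    (@tnth n T ^~ i @^-1` A i)).
  apply: fin_bigcap_measurable => // i _; rewrite -[_ @^-1` _]setTI.
  exact: measurable_tnth.
by apply/seteqP; split=> t At i; [move=> _; exact: At|exact: At].
Qed.

(** Boxes are stable under intersection and generate, so finite measures on
    tuples can be compared on boxes: this is how independence, which only speaks
    of boxes, is transferred to arbitrary measurable sets of tuples. *)
Lemma measurable_tuple_boxes n :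
  (measurable : set (set (n.-tuple T))) = <<s @boxes n >>.
Proof.
apply/seteqP; split; last first.
  apply: smallest_sub; first exact: sigma_algebra_measurable.
  by move=> _ [A mA <-]; exact: measurable_box.
apply: smallest_sub; first exact: smallest_sigma_algebra.
rewrite -bigcup_seq; apply: bigcup_sub => i _ _ [B mB <-].
apply: sub_gen_smallest; rewrite setTI.
exists (fun j => if j == i then B else setT) => /=.
  by move=> j; case: ifP.
apply/seteqP; split => [t /= /(_ i)|t /= Bt j]; first by rewrite eqxx.
by case: eqP => // ->.
Qed.

Lemma boxes_setI n : setI_closed (@boxes n).
Proof.
move=> _ _ [A mA <-] [B mB <-]; exists (fun i => A i `&` B i).
  by move=> i; exact: measurableI.
apply/seteqP; split=> [t /= h|t /= [h1 h2] i]; last by split.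
by split=> i; have [] := h i.
Qed.

End boxes.

Section independent_tuple.
Context {R : realType} {disp disp'} {T : measurableType disp}
  {E : measurableType disp'} (P : probability T R).

Definition sample (X : nat -> T -> E) n (w : T) : n.-tuple E :=
  [tuple X i w | i < n].

Lemma measurable_sample (X : nat -> {RV P >-> E}) n :
  measurable_fun setT (sample X n).
Proof.
apply/measurable_fun_tnthP => i.
rewrite (_ : _ \o _ = X i); first exact: measurable_funP.
by apply/funext => w /=; rewrite tnth_mktuple.
Qed.

Lemma measurable_preimage_RV (X : {RV P >-> E}) (B : set E) :
  measurable B -> measurable (X @^-1` B).
Proof. by move=> mB; rewrite -[_ @^-1` _]setTI; apply: measurable_funP. Qed.

Lemma measurable_preimage_sample (X : nat -> {RV P >-> E}) n (A : set (n.-tuple E)) :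
  measurable A -> measurable (sample X n @^-1` A).
Proof. by move=> mA; rewrite -[_ @^-1` _]setTI; apply: measurable_sample. Qed.

HB.instance Definition _ (X : nat -> {RV P >-> E}) n :=
  isMeasurableFun.Build _ _ _ _ (sample X n) (@measurable_sample X n).

Definition shift_seq (X : nat -> {RV P >-> E}) : nat -> {RV P >-> E} :=
  fun i => X i.+1.

Lemma shift_independent (X : nat -> {RV P >-> E}) :
  mutually_independent X -> mutually_independent (shift_seq X).
Proof.
move=> iX s A us mA.
have := iX (map S s) (fun i => A i.-1).
rewrite map_inj_uniq ?us; last exact: succn_inj.
move=> /(_ erefl (fun i => mA _)).
rewrite big_map /= => <-; congr (P _).
apply/seteqP; split=> w /= h i.
  by move=> /= /mapP[j js ->]; exact: h.
by move=> /= si; apply: (h i.+1); rewrite /= map_f.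
Qed.

Lemma sample_cons (X : nat -> {RV P >-> E}) n w :
  sample X n.+1 w = [tuple of X 0%N w :: sample (shift_seq X) n w].
Proof.
apply: eq_from_tnth => i; rewrite tnth_mktuple.
case: (unliftP ord0 i) => [j|] -> //.
by rewrite tnthS tnth_mktuple.
Qed.

(** Both sides are finite measures in A, and they agree on boxes by mutual
    independence. *)
Lemma independent_head (X : nat -> {RV P >-> E}) n (B : set E)
    (A : set (n.-tuple E)) : mutually_independent X ->
  measurable B -> measurable A ->
  P (X 0%N @^-1` B `&` sample (shift_seq X) n @^-1` A) =
  (P (X 0%N @^-1` B) * P (sample (shift_seq X) n @^-1` A))%E.
Proof.
move=> iX mB mA.
have mXB := measurable_preimage_RV (X 0%N) mB.
have mS : measurable_fun setT (sample (shift_seq X) n) by exact: measurable_sample.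
have PBfin : P (X 0%N @^-1` B) \is a fin_num by exact: fin_num_measure.
have r0 : 0 <= fine (P (X 0%N @^-1` B)) by exact: fine_ge0.
pose m1 :=
  pushforward (mrestr P mXB) (sample (shift_seq X) n) : {measure set (n.-tuple E) -> \bar R}.
pose m2 :=
  mscale (NngNum r0) (pushforward P (sample (shift_seq X) n)) : {measure set (n.-tuple E) -> \bar R}.
suff : m1 mS A = m2 mS A.
  rewrite /m1 /m2 /= /pushforward /mrestr /mscale /= fineK// => <-.
  by rewrite setIC.
apply: (measure_unique (@boxes _ _ n) (fun=> setT)) => //.
- exact: measurable_tuple_boxes.
- exact: boxes_setI.
- move=> _; exists (fun=> setT) => //; apply/seteqP; split=> //.
- by apply/seteqP; split=> // t _; exists 0%N.
- move=> _ [C mC <-].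
  rewrite /m1 /m2 /= /pushforward /mrestr /mscale /= fineK// setIC.
  (* B for the head, then the sides of the box, then no constraint *)
  pose A' (i : nat) : set E := if i is j.+1 then
     (if insub j is Some k then C k else setT) else B.
  have mA' i : measurable (A' i).
    by case: i => //= j; case: insubP.
  have := iX (iota 0 n.+1) A' (iota_uniq _ _) mA'.
  rewrite (_ : \bigcap_(i in _) _ =
     X 0%N @^-1` B `&` sample (shift_seq X) n @^-1` box C); last first.
    apply/seteqP; split=> w /=.
      move=> h; split; first by apply: (h 0%N); rewrite /= inE.
      move=> i; rewrite tnth_mktuple /shift_seq.
      have := h i.+1; rewrite /= (valK i); apply.
      by rewrite inE/= mem_iota/= add1n ltnS.
    move=> [h0 h] [|i] //= _; case: insubP => //= k _ ki.
    by have := h k; rewrite tnth_mktuple /shift_seq ki.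
  move=> ->; rewrite -[iota _ _]/(0%N :: iota 1 n) big_cons; congr (_ * _)%E.
  have := shift_independent iX (iota_uniq 0 n) (fun i => mA' i.+1).
  rewrite (_ : \bigcap_(i in _) _ = sample (shift_seq X) n @^-1` box C); last first.
    apply/seteqP; split=> w /=.
      move=> h i; rewrite tnth_mktuple.
      have := h i; rewrite /= (valK i); apply.
      by rewrite mem_iota/=.
    move=> h i //= _; case: insubP => //= k _ ki.
    by have := h k; rewrite tnth_mktuple ki.
  move=> h; rewrite [RHS]h.
  by rewrite -[1%N]/(1 + 0)%N iotaDl big_map.
- move=> _; rewrite /m1 /= /pushforward /mrestr /=.
  apply: (@le_lt_trans _ _ 1%E); last exact: ltry.
  by apply: probability_le1; apply: measurableI => //; rewrite preimage_setT.
Qed.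

End independent_tuple.

(** * Integration against a density, and sections of a sample *)

Section integral_density.
Context {R : realType} {disp} {E : measurableType disp}.
Local Open Scope ereal_scope.
Import HBNNSimple.

(** Both integrals are limits along simple functions increasing to h, and for
    simple functions the equality is the hypothesis on nu. *)
Lemma ge0_integral_density (mu nu : {measure set E -> \bar R}) (w : E -> R)
    (h : E -> \bar R) :
  measurable_fun [set: E] w -> (forall x, (0 <= w x)%R) ->
  (forall A, measurable A -> nu A = \int[mu]_(x in A) (w x)%:E) ->
  measurable_fun [set: E] h -> (forall x, 0 <= h x) ->
  \int[nu]_x h x = \int[mu]_x (h x * (w x)%:E).
Proof.
move=> mw w0 nuE mh h0.
have mT : measurable [set: E] by exact: measurableT.
pose f_ := nnsfun_approx mT mh.
have cvf x : (f_ n x)%:E @[n --> \oo] --> h x.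
  by apply: cvg_nnsfun_approx.
transitivity (limn (fun n => \int[nu]_x (f_ n x)%:E)).
  rewrite -monotone_convergence//.
  - by apply: eq_integral => y _; apply/esym/cvg_lim => //; exact: cvf.
  - by move=> n; exact/measurable_EFinP/measurable_funP.
  - by move=> n y _; rewrite lee_fin.
  - by move=> y _ m n mn; rewrite lee_fin; exact/lefP/nd_nnsfun_approx.
transitivity (limn (fun n => \int[mu]_x ((f_ n x)%:E * (w x)%:E))); last first.
  rewrite -monotone_convergence//; last 3 first.
  - move=> n; apply: emeasurable_funM; exact/measurable_EFinP.
  - by move=> n x _; rewrite mule_ge0// lee_fin.
  - move=> y _ m n mn; rewrite lee_wpmul2r ?lee_fin//.
    exact/lefP/nd_nnsfun_approx.
  apply: eq_integral => y _; apply/cvg_lim => //.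
  by apply: cvgeZr => //; exact: cvf.
congr (limn _); apply/funext => n.
have mfn r : measurable (f_ n @^-1` [set r]).
  by rewrite -[_ @^-1` _]setTI; exact: measurable_funP.
transitivity (\sum_(k \in range (f_ n))
    \int[nu]_x (k * \1_(f_ n @^-1` [set k]) x)%:E).
  under eq_integral do rewrite fimfunE -fsumEFin//.
  rewrite ge0_integral_fsum//; last 2 first.
  - by move=> y; exact/measurable_EFinP/measurable_funM.
  - by move=> y x _; rewrite nnfun_muleindic_ge0.
transitivity (\sum_(k \in range (f_ n))
    \int[mu]_x ((k * \1_(f_ n @^-1` [set k]) x)%:E * (w x)%:E)).
  apply: eq_fsbigr => r _.
  rewrite integralZl_indic_nnsfun// integral_indic// setIT nuE//.
  have [r0|r0] := ltP r 0%R.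
    rewrite preimage_nnfun0// integral_set0 mule0.
    by rewrite integral0_eq// => x _; rewrite indic0 mulr0 mul0e.
  have mwA : measurable_fun (f_ n @^-1` [set r]) (fun x => (w x)%:E).
    by apply: measurable_funTS; exact/measurable_EFinP.
  have wA x : (f_ n @^-1` [set r]) x -> 0 <= (w x)%:E by rewrite lee_fin.
  rewrite -ge0_integralZl//.
  rewrite integral_mkcond; apply: eq_integral => x _.
  rewrite patchE indicE; case: ifPn => _; first by rewrite mulr1.
  by rewrite mulr0 mul0e.
rewrite -ge0_integral_fsum//; last 2 first.
  - move=> y; apply: emeasurable_funM; last exact/measurable_EFinP.
    exact/measurable_EFinP/measurable_funM.
  - move=> y x _; rewrite mule_ge0// ?lee_fin//.
    by have := nnfun_muleindic_ge0 (f_ n) y x; rewrite -EFinM lee_fin.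
apply: eq_integral => x _.
rewrite [in RHS]fimfunE -fsumEFin// ge0_mule_fsuml//.
by move=> y; have := nnfun_muleindic_ge0 (f_ n) y x; rewrite -EFinM.
Qed.

End integral_density.

Section sections.
Context {R : realType} {disp disp'} {T : measurableType disp}
  {E : measurableType disp'} (P : probability T R).
Implicit Types (X : nat -> {RV P >-> E}).
Local Open Scope ereal_scope.

Definition tuple_section n (A : set (n.+1.-tuple E)) (x : E) : set (n.-tuple E) :=
  [set t : n.-tuple E | A [the n.+1.-tuple E of x :: t]].

Lemma measurable_tuple_section n (A : set (n.+1.-tuple E)) x :
  measurable A -> measurable (tuple_section A x).
Proof.
move=> mA; rewrite -[tuple_section _ _]setTI.
have /(_ measurableT A mA) := @measurable_cons _ _ _ _ (fun=> x) n idfun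
  (measurable_cst _) (@measurable_id _ _ _).
exact.
Qed.

(** Tonelli for the head and the tail of a sample, whose joint law is the
    product of their laws by independent_head. *)
Lemma sample_sectionP X n (A : set (n.+1.-tuple E)) :
  mutually_independent X -> measurable A ->
  measurable_fun setT
    (fun x => P (sample (shift_seq X) n @^-1` tuple_section A x)) /\
  P (sample X n.+1 @^-1` A) =
  \int[distribution P (X 0%N)]_x
     P (sample (shift_seq X) n @^-1` tuple_section A x).
Proof.
move=> iX mA.
pose B : set (E * n.-tuple E) := [set z : E * n.-tuple E | A [the n.+1.-tuple E of z.1 :: z.2]].
have mB : measurable B.
  rewrite -[B]setTI.
  have := @measurable_cons _ _ _ _ (@fst E (n.-tuple E)) n snd
    measurable_fst measurable_snd.
  exact.
pose Q : probability (n.-tuple E) R := distribution P (sample (shift_seq X) n).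
have QE x : Q (xsection B x) =
    P (sample (shift_seq X) n @^-1` tuple_section A x).
  rewrite /Q /distribution /= /pushforward; congr (P _).
  by apply/seteqP; split=> w /=; rewrite /xsection /= in_setE.
split.
  have := measurable_fun_xsection Q mB.
  by apply: eq_measurable_fun => x _; rewrite /= QE.
under eq_integral do rewrite -QE.
pose phi (w : T) := (X 0%N w, sample (shift_seq X) n w).
have mphi : measurable_fun setT phi.
  by apply: measurable_fun_pair => //; exact: measurable_sample.
have := @product_measure_unique _ _ _ _ _ (distribution P (X 0%N)) Q
  (pushforward P phi).
move=> /(_ mphi) h.
transitivity (pushforward P phi B).
  rewrite /pushforward; congr (P _); apply/seteqP.
  by split=> w /=; rewrite /B/= sample_cons.
rewrite -h//.
move=> C D mC mD.
exact: independent_head.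
Qed.

End sections.

(** * Affinity of two product laws *)

Section affinity.
Context {R : realType} {disp disp'} {T : measurableType disp}
  {E : measurableType disp'} (P : probability T R)
  (mu : {measure set E -> \bar R}).
Implicit Types (X Y : nat -> {RV P >-> E}) (f g : E -> R).
Local Open Scope ereal_scope.

(** The law of each point has density f^2; working with the square root makes
    the affinity of two laws the integral of f g. *)
Definition root_density f X := forall i (A : set E), measurable A ->
  distribution P (X i) A = \int[mu]_(x in A) ((f x ^+ 2)%R)%:E.

(** The form of sample_sectionP used in the induction of affinity_tensor: the
    sections of the event become a real function u, integrated against the
    density. *)
Lemma sample_density X f n (A : set (n.+1.-tuple E)) :
  measurable_fun [set: E] f ->
  mutually_independent X -> root_density f X -> measurable A ->
  exists u : E -> R,
    [/\ measurable_fun [set: E] u, forall x, (0 <= u x)%R,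
     forall x, P (sample (shift_seq X) n @^-1` tuple_section A x) = (u x)%:E &
     P (sample X n.+1 @^-1` A) = \int[mu]_x (u x * f x ^+ 2)%:E].
Proof.
move=> mf iX dX mA; have [mu_ ->] := sample_sectionP iX mA.
have mS x : measurable (sample (shift_seq X) n @^-1` tuple_section A x).
  by apply: measurable_preimage_sample; exact: measurable_tuple_section.
exists (fun x => fine (P (sample (shift_seq X) n @^-1` tuple_section A x))).
have finP x : (fine (P (sample (shift_seq X) n @^-1` tuple_section A x)))%:E =
  P (sample (shift_seq X) n @^-1` tuple_section A x).
  by rewrite fineK//; exact: fin_num_measure.
split=> //.
- apply/measurable_EFinP; move: mu_; apply: eq_measurable_fun => x _ /=.
  by rewrite finP.
- by move=> x; apply: fine_ge0.
- have mf2 : measurable_fun [set: E] (fun x => f x ^+ 2)%R by exact: measurable_funX.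
  have f20 x : (0 <= f x ^+ 2)%R by exact: sqr_ge0.
  rewrite (ge0_integral_density mf2 f20 (dX 0%N))//.
  by apply: eq_integral => x _; rewrite [in RHS]EFinM finP.
Qed.

(** The inductive step of affinity_tensor at a fixed first point, where the two
    densities take the values f^2 and g^2: the weights a and b are multiplied by
    f / g, and the inequality obtained is multiplied by f g. *)
Lemma scaled_mix_ge (r a b u v u' v' f g : R) :
  (0 < a)%R -> (0 < b)%R -> (0 <= f)%R -> (0 <= g)%R ->
  (0 <= u)%R -> (0 <= v)%R -> (0 <= u')%R -> (0 <= v')%R ->
  (forall a b : R, 0 < a -> 0 < b ->
     2 * r <= a * u + a^-1 * v + b * u' + b^-1 * v')%R ->
  (2 * r * (f * g) <= a * (u * f ^+ 2) + a^-1 * (v * g ^+ 2) +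
     b * (u' * f ^+ 2) + b^-1 * (v' * g ^+ 2))%R.
Proof.
move=> a0 b0 f0 g0 u0 v0 u'0 v'0 h.
have [fg|fg] := eqVneq (f * g)%R 0%R.
  have t (k w h0 : R) : (0 < k)%R -> (0 <= w)%R -> (0 <= k * (w * h0 ^+ 2))%R.
    by move=> /ltW k0 w0; exact: mulr_ge0 k0 (mulr_ge0 w0 (sqr_ge0 _)).
  by rewrite fg mulr0 !addr_ge0// t ?invr_gt0.
have {}f0 : (0 < f)%R by rewrite lt0r f0 andbT; apply: contra_neq fg => ->; rewrite mul0r.
have {}g0 : (0 < g)%R by rewrite lt0r g0 andbT; apply: contra_neq fg => ->; rewrite mulr0.
have := h (a * f / g)%R (b * f / g)%R.
rewrite !divr_gt0 ?mulr_gt0// => /(_ erefl erefl) {}h.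
apply: le_trans (ler_wpM2r (ltW (mulr_gt0 f0 g0)) h) _.
rewrite le_eqVlt; apply/orP; left; apply/eqP; field.
by rewrite !lt0r_neq0.
Qed.

Lemma AMGM_inv (a : R) : (0 < a)%R -> (2 <= a + a^-1)%R.
Proof.
move=> a0; rewrite -subr_ge0.
rewrite (_ : (a + a^-1 - 2 = (a - 1) ^+ 2 / a)%R); last by field; rewrite lt0r_neq0.
by rewrite divr_ge0 ?sqr_ge0// ltW.
Qed.

(** The Hellinger affinity of two laws mu, nu is at most
    sqrt (mu A nu A) + sqrt (mu A^c nu A^c) for every event A, and it is
    multiplicative over independent products.  Each square root is replaced here
    by the linear expression 2 sqrt (x y) <= a x + y / a with a free weight a.
    This linear form passes through integrals, so the induction on n goes
    section by section: the statement for n, with weights depending on the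
    first point, integrates to the statement for n + 1. *)
Lemma affinity_tensor f g (r : R) : (0 <= r)%R ->
  measurable_fun [set: E] f -> measurable_fun [set: E] g ->
  (forall x, 0 <= f x)%R -> (forall x, 0 <= g x)%R ->
  r%:E <= \int[mu]_x (f x * g x)%:E ->
  forall n X Y (A : set (n.-tuple E)) (a b : R),
  mutually_independent X -> mutually_independent Y ->
  root_density f X -> root_density g Y ->
  measurable A -> (0 < a)%R -> (0 < b)%R ->
  (2 * r ^+ n)%:E <=
    a%:E * P (sample X n @^-1` A) + (a^-1)%:E * P (sample Y n @^-1` A) +
    b%:E * P (sample X n @^-1` (~` A)) + (b^-1)%:E * P (sample Y n @^-1` (~` A)).
Proof.
move=> r0 mf mg f0 g0 rfg; elim=> [|n IH] X Y A a b iX iY dX dY mA a0 b0.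
  have sE (Z : nat -> {RV P >-> E}) (B : set (0.-tuple E)) :
      sample Z 0 @^-1` B = (if `[< B [tuple] >] then setT else set0).
    apply/seteqP; split=> w /=; case: asboolP => // h; rewrite ?(tuple0 (sample Z 0 w))//.
  rewrite !sE; case: asboolP => hA; case: asboolP => // hA'.
  rewrite !measure0 probability_setT !mule0 !mule1 !adde0 -EFinD lee_fin.
    by rewrite mulr1 AMGM_inv.
  rewrite !measure0 probability_setT !mule0 !mule1 !add0e -EFinD lee_fin.
  by rewrite mulr1 AMGM_inv.
have mAC := measurableC mA.
have [u [mu' u0 uE ->]] := sample_density mf iX dX mA.
have [v [mv v0 vE ->]] := sample_density mg iY dY mA.
have [u' [mu'' u'0 u'E ->]] := sample_density mf iX dX mAC.
have [v' [mv' v'0 v'E ->]] := sample_density mg iY dY mAC.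
have mm (w h : E -> R) : measurable_fun [set: E] w -> measurable_fun [set: E] h ->
    measurable_fun [set: E] (fun x => (w x * h x ^+ 2)%:E).
  move=> mw mh; apply/measurable_EFinP; apply: measurable_funM => //.
  exact: measurable_funX.
have mmk (k : R) (w h : E -> R) : measurable_fun [set: E] w -> measurable_fun [set: E] h ->
    measurable_fun [set: E] (fun x => k%:E * (w x * h x ^+ 2)%:E).
  by move=> mw mh; apply: measurable_funeM; exact: mm.
have nn (w h : E -> R) x : (forall x, 0 <= w x)%R -> 0 <= (w x * h x ^+ 2)%:E.
  by move=> w0; rewrite lee_fin; exact: mulr_ge0 (w0 _) (sqr_ge0 _).
have ia : 0 <= (a^-1)%:E by rewrite lee_fin invr_ge0 ltW.
have ib : 0 <= (b^-1)%:E by rewrite lee_fin invr_ge0 ltW.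
have ka : 0 <= a%:E by rewrite lee_fin ltW.
have kb : 0 <= b%:E by rewrite lee_fin ltW.
rewrite -!ge0_integralZl//; try (by move=> *; exact: nn); try exact: mm.
rewrite -!ge0_integralD//; try (by move=> *; rewrite ?adde_ge0// mule_ge0// nn);
  try (by do ?[apply: emeasurable_funD]; exact: mmk).
apply: (@le_trans _ _ (\int[mu]_x ((2 * r ^+ n)%:E * (f x * g x)%:E))).
  rewrite ge0_integralZl//; last 3 first.
  - by apply/measurable_EFinP; exact: measurable_funM.
  - by move=> x _; rewrite lee_fin mulr_ge0.
  - by rewrite lee_fin mulr_ge0// exprn_ge0.
  apply: le_trans (lee_wpmul2l _ rfg); last by rewrite lee_fin mulr_ge0// exprn_ge0.
  by rewrite -EFinM lee_fin exprSr mulrA.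
apply: ge0_le_integral => //.
- by move=> x _; rewrite mule_ge0// lee_fin ?mulr_ge0// exprn_ge0.
- apply: measurable_funeM; apply/measurable_EFinP; exact: measurable_funM.
- by do ?[apply: emeasurable_funD]; exact: mmk.
move=> x _; rewrite -!EFinM -!EFinD lee_fin.
apply: scaled_mix_ge => // a1 b1 a10 b10.
have := IH _ _ _ _ _ (shift_independent iX) (shift_independent iY)
  (fun i => dX i.+1) (fun i => dY i.+1) (measurable_tuple_section x mA) a10 b10.
rewrite uE vE.
have -> : (~` tuple_section A x) = tuple_section (~` A) x by [].
by rewrite u'E v'E -!EFinM -!EFinD lee_fin.
Qed.

End affinity.

(** * Lebesgue measure on tuples: dilations, null hyperplanes, decay *)

Section lebesgue_tuple_theory.
Context {R : realType}.
Implicit Types (d : nat) (c : R).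

Definition scale_tuple d c (t : d.-tuple R) : d.-tuple R :=
  [tuple c * tnth t i | i < d].

Lemma measurable_scale_tuple d c :
  measurable_fun [set: d.-tuple R] (scale_tuple c).
Proof.
apply/measurable_fun_tnthP => i.
rewrite (_ : _ \o _ = fun t => c * tnth t i); last first.
  by apply/funext => t /=; rewrite tnth_mktuple.
by apply: measurable_funM => //; exact: measurable_tnth.
Qed.

Lemma scale_tupleA d a b (t : d.-tuple R) :
  scale_tuple a (scale_tuple b t) = scale_tuple (a * b) t.
Proof. by apply: eq_from_tnth => i; rewrite !tnth_mktuple mulrA. Qed.

Lemma scale_tuple1 d (t : d.-tuple R) : scale_tuple 1 t = t.
Proof. by apply: eq_from_tnth => i; rewrite tnth_mktuple mul1r. Qed.

Definition centered_box d (k : nat) : set (d.-tuple R) :=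
  box (fun=> `[- k%:R, k%:R]%classic : set R).

Lemma lebesgue_measure_symm_itv (a r : R) : 0 <= r ->
  lebesgue_measure (`[a - r, a + r]%classic : set R) = (r + r)%:E.
Proof.
move=> r0; rewrite lebesgue_measure_itv/= lte_fin -EFinB.
rewrite (_ : a + r - (a - r) = r + r); last by ring.
case: ltP => // h; congr EFin; apply/eqP; rewrite eq_le addr_ge0//=.
by move: h; rewrite lerD2l => h; lra.
Qed.

Lemma lebesgue_tuple_centered_box d k :
  (lebesgue_tuple R d (@centered_box d k) < +oo)%E.
Proof.
rewrite /centered_box lebesgue_tuple_box//.
under eq_bigr => i _ do rewrite -[- k%:R]add0r -[X in `[_, X]]add0r lebesgue_measure_symm_itv//.
by rewrite prodEFin ltry.
Qed.

Lemma bigcup_centered_box d : \bigcup_k @centered_box d k = setT.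
Proof.
apply/seteqP; split=> // t _.
exists (Num.truncn (\sum_i `|tnth t i|)).+1 => // i.
rewrite /= in_itv/= -ler_norml.
apply: le_trans (ltW (truncnS_gt _)).
by rewrite (bigD1 i)//= lerDl sumr_ge0.
Qed.

Lemma sigma_finite_lebesgue_tuple d :
  sigma_finite [set: d.-tuple R] (lebesgue_tuple R d).
Proof.
exists (@centered_box d); first by rewrite bigcup_centered_box.
by move=> k; split; [exact: measurable_box|exact: lebesgue_tuple_centered_box].
Qed.

HB.instance Definition _ d := Measure_isSigmaFinite.Build _ _ _
  (lebesgue_tuple R d) (@sigma_finite_lebesgue_tuple d).

Lemma lebesgue_measure_scale c (A : set R) : 0 < c -> measurable A ->
  lebesgue_measure ((fun x => c * x) @^-1` A) = ((c^-1)%:E * lebesgue_measure A)%E.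
Proof.
move=> c0 mA.
have mc : measurable_fun [set: measurableTypeR R]
    ((fun x => c * x) : measurableTypeR R -> measurableTypeR R).
  by apply: measurable_funM.
pose m := (mscale (NngNum (ltW c0)) (pushforward lebesgue_measure
   ((fun x => c * x) : measurableTypeR R -> measurableTypeR R)) :
   {measure set (measurableTypeR R) -> \bar R}).
have -> : lebesgue_measure A = m mc A.
  apply: lebesgue_measure_unique => // _ [[a b]] _ <-.
  have -> : m mc `]a, b]%classic =
      (c%:E * lebesgue_measure (`](a / c)%R, (b / c)%R]%classic : set R))%E.
    congr (_ * lebesgue_measure _)%E.
    by apply/seteqP; split=> x /=;
      rewrite !in_itv/= ltr_pdivrMr// ler_pdivlMr// ![x * c]mulrC.
  rewrite !lebesgue_measure_itv/= !lte_fin ltr_pM2r ?invr_gt0//.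
  case: ifP => _; last by rewrite mule0.
  by rewrite -!EFinB -EFinM -mulrBl mulrCA divff ?lt0r_neq0// mulr1.
by rewrite /m /= /mscale /pushforward/= muleA -EFinM mulVf ?lt0r_neq0// mul1e.
Qed.

(** Both sides are sigma-finite measures in A that agree on boxes, where the
    one-dimensional scaling applies to each side of the box. *)
Lemma lebesgue_tuple_scale d c (A : set (d.-tuple R)) : 0 < c -> measurable A ->
  lebesgue_tuple R d (scale_tuple c @^-1` A) =
  ((c^-1 ^+ d)%:E * lebesgue_tuple R d A)%E.
Proof.
move=> c0 mA; have mc := @measurable_scale_tuple d c.
have i0 : 0 <= c^-1 ^+ d by rewrite exprn_ge0// invr_ge0 ltW.
pose m1 := (pushforward (lebesgue_tuple R d) (scale_tuple c) :
   {measure set (d.-tuple R) -> \bar R}).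
pose m2 := (mscale (NngNum i0) (lebesgue_tuple R d) :
   {measure set (d.-tuple R) -> \bar R}).
suff : m1 mc A = m2 A by [].
have E (B : 'I_d -> set R) : (forall i, measurable (B i)) -> m1 mc (box B) = m2 (box B).
  move=> mB; rewrite /m1 /m2 /= /pushforward /mscale /=.
  rewrite (_ : scale_tuple c @^-1` box B = box (fun i => (fun x => c * x) @^-1` B i)); last first.
    by apply/seteqP; split=> t h i /=; have := h i; rewrite /= tnth_mktuple.
  have mB' i : measurable ((fun x => c * x) @^-1` B i).
    rewrite -[_ @^-1` _]setTI.
    by apply: (measurable_funM (measurable_cst c) (@measurable_id _ _ setT)).
  rewrite !lebesgue_tuple_box//.
  under eq_bigr do rewrite lebesgue_measure_scale//.
  rewrite big_split/=; congr (_ * _)%E.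
  by rewrite prodEFin prodr_const card_ord.
apply: (measure_unique (@boxes _ _ d) (@centered_box d)) => //.
- exact: measurable_tuple_boxes.
- exact: boxes_setI.
- by move=> k; exists (fun=> `[- k%:R, k%:R]%classic : set R).
- exact: bigcup_centered_box.
- by move=> _ [B mB <-]; exact: E.
- move=> k; rewrite [ltLHS]E// /m2 /= /mscale /=.
  by rewrite lte_mul_pinfty// lebesgue_tuple_centered_box.
Qed.

Lemma lebesgue_tuple_hyperplane d (i : 'I_d) :
  lebesgue_tuple R d [set t | tnth t i = 0] = 0%E.
Proof.
rewrite (_ : [set _ | _] =
    box (fun j => (if j == i then [set 0] else setT) : set R)); last first.
  apply/seteqP; split=> t /= h; last by have := h i; rewrite eqxx.
  by move=> j; case: eqP => // ->.
rewrite lebesgue_tuple_box; last by move=> j; case: ifP.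
by rewrite (bigD1 i)//= eqxx lebesgue_measure_set1 mul0e.
Qed.

(** By Tonelli the integral is the d-th power of the one-dimensional
    integral. *)
Lemma integral_tuple_prod d (h : R -> R) : measurable_fun [set: R] h ->
  (forall x, 0 <= h x) ->
  (\int[lebesgue_measure]_x (h x)%:E < +oo)%E ->
  (\int[lebesgue_tuple R d]_t (\prod_i h (tnth t i))%:E < +oo)%E.
Proof.
move=> mh h0 hoo.
have mP n : measurable_fun [set: n.-tuple R] (fun t => (\prod_i h (tnth t i))%:E).
  apply/measurable_EFinP; apply: measurable_prod => i _.
  by apply: measurableT_comp => //; exact: measurable_tnth.
have P0 n (t : n.-tuple R) : 0 <= \prod_i h (tnth t i) by exact: prodr_ge0.
elim: d => [|d IH].
  under eq_integral do rewrite big_ord0.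
  rewrite integral_cst//= mul1e diracE; case: (_ \in _); exact: ltry.
have mcp : measurable_fun [set: (d.-tuple R * measurableTypeR R)%type]
    (@cons_pair R d : d.-tuple R * measurableTypeR R -> d.+1.-tuple R).
  exact: measurable_cons_pair.
have := @ge0_integral_pushforward _ _ (d.-tuple R * measurableTypeR R)%type
  (d.+1.-tuple R) R (@cons_pair R d) mcp
  (lebesgue_tuple R d \x lebesgue_measure)%E setT
  (fun t => (\prod_i h (tnth t i))%:E) measurableT (mP _).
rewrite preimage_setT => H.
rewrite [ltLHS]H; last by move=> t _; rewrite lee_fin.
have mg : measurable_fun [set: (d.-tuple R * measurableTypeR R)%type]
    (fun z => (\prod_i h (tnth z.1 i) * h z.2)%:E).
  apply/measurable_EFinP; apply: measurable_funM.
    have /measurable_EFinP := mP d.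
    by move=> /measurableT_comp; apply; exact: measurable_fst.
  by apply: measurableT_comp => //; exact: measurable_snd.
rewrite (_ : (_ \o _) = (fun z => (\prod_i h (tnth z.1 i) * h z.2)%:E)); last first.
  apply/funext => z /=; congr (_%:E).
  rewrite big_ord_recl mulrC; congr (_ * _).
  by apply: eq_bigr => i _; rewrite tnthS.
rewrite fubini_tonelli1//; last first.
  by move=> z; rewrite lee_fin mulr_ge0.
rewrite /fubini_F/=.
have hE : (\int[lebesgue_measure]_x (h x)%:E = (fine (\int[lebesgue_measure]_x (h x)%:E))%:E)%E.
  by rewrite fineK// ge0_fin_numE//; apply: integral_ge0 => x _; rewrite lee_fin.
have I0 : 0 <= fine (\int[lebesgue_measure]_x (h x)%:E).
  by apply: fine_ge0; apply: integral_ge0 => x _; rewrite lee_fin.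
have mhE : measurable_fun [set: measurableTypeR R] (fun x => (h x)%:E).
  exact/measurable_EFinP.
have hE0 x : setT x -> (0 <= (h x)%:E)%E by rewrite lee_fin.
rewrite (eq_integral (fun t : d.-tuple R =>
    (fine (\int[lebesgue_measure]_x (h x)%:E))%:E * (\prod_i h (tnth t i))%:E)%E);
    last first.
  move=> t _; under eq_integral do rewrite EFinM.
  have Pt : (0 <= (\prod_i h (tnth t i))%:E)%E by rewrite lee_fin.
  by rewrite ge0_integralZl// muleC [X in (X * _)%E]hE.
have Pt (t : d.-tuple R) : setT t -> (0 <= (\prod_i h (tnth t i))%:E)%E.
  by rewrite lee_fin.
have mPd := mP d.
by rewrite ge0_integralZl ?lee_fin// lte_mul_pinfty// lee_fin.
Qed.

Lemma integral_tuple_oneDsqrV d :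
  (\int[lebesgue_tuple R d]_t (\prod_i (1 + tnth t i ^+ 2)^-1)%:E < +oo)%E.
Proof.
apply: (@integral_tuple_prod d (fun x => (1 + x ^+ 2)^-1)).
- apply: continuous_measurable_fun => x; exact: continuous_oneDsqrV.
- by move=> x; rewrite invr_ge0 addr_ge0// sqr_ge0.
- rewrite (@ge0_symfun_integralT _ (fun x : R => (1 + x ^+ 2)^-1))//=.
  + rewrite (_ : [set x | 0 <= x] = `[0, +oo[%classic); last first.
      by apply/seteqP; split => x/=; rewrite in_itv/= andbT.
    by rewrite [X in (_ * X)%E](integral0y_oneDsqr R) -EFinM ltry.
  + by move=> x; rewrite invr_ge0 addr_ge0// sqr_ge0.
  + exact: continuous_oneDsqrV.
  + by move=> x /=; rewrite sqrrN.
Qed.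

End lebesgue_tuple_theory.

(** * Decay of the square root of a density *)

Section potential.
Context {R : realType} {d : nat}.
Implicit Types (U : set 'rV[R]_d) (g V : 'rV[R]_d -> R) (x y : 'rV[R]_d).

(** The square of the Japanese bracket: a weight at least 1 that measures
    polynomial growth and decay on the whole space. *)
Definition bracket2 x : R := 1 + \sum_i x 0 i ^+ 2.

Lemma bracket2E x : bracket2 x = 1 + enorm x ^+ 2.
Proof. by rewrite /enorm sqr_sqrtr// sumr_ge0// => i _; exact: sqr_ge0. Qed.

Lemma bracket2_ge1 x : 1 <= bracket2 x.
Proof. by rewrite lerDl sumr_ge0// => i _; exact: sqr_ge0. Qed.

Lemma bracket2_gt0 x : 0 < bracket2 x.
Proof. exact: lt_le_trans ltr01 (bracket2_ge1 x). Qed.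

Lemma enorm_ge0 x : 0 <= enorm x.
Proof. exact: sqrtr_ge0. Qed.

Lemma coord_le_enorm x i : `|x 0 i| <= enorm x.
Proof.
rewrite /enorm -sqrtr_sqr; apply: ler_wsqrtr.
by rewrite (bigD1 i)//= lerDl sumr_ge0// => j _; exact: sqr_ge0.
Qed.

Lemma coord_le_bracket2 x i : `|x 0 i| <= bracket2 x.
Proof.
apply: le_trans (coord_le_enorm x i) _; rewrite bracket2E.
by have := sqr_ge0 (enorm x - 1); have := enorm_ge0 x; nra.
Qed.

(** For a potential on the open orthant this asks for bounds up to the
    boundary, which continuity on the open orthant alone would not give. *)
Definition locally_bounded_on U g :=
  forall M : R, exists B : R, forall x, U x -> enorm x <= M -> `|g x| <= B.

(** The part of a product of closed sets lying in a cube is compact. *)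
Lemma continuous_locally_bounded (S : set R) g : closed S ->
  {within [set x : 'rV[R]_d | forall i, S (x 0 i)], continuous g} ->
  locally_bounded_on [set x : 'rV[R]_d | forall i, S (x 0 i)] g.
Proof.
move=> cS cg M.
pose A (i : 'I_d) : set R := `[- M, M]%classic `&` S.
have cA : compact [set x : 'rV[R]_d | forall i, A i (x ord0 i)].
  apply: rV_compact => i.
  by apply: compact_closedI => //; exact: segment_compact.
have cgA : {within [set x : 'rV[R]_d | forall i, A i (x ord0 i)], continuous g}.
  by apply: continuous_subspaceW cg => x Ax i; have [] := Ax i.
have /compact_bounded[N [_ Nb]] := continuous_compact cgA cA.
exists (N + 1) => x Sx xM; apply: (Nb (N + 1)); first by rewrite ltrDl.
exists x => // i; split => //=.
by rewrite in_itv/= -ler_norml; exact: le_trans (coord_le_enorm x i) xM.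
Qed.

Lemma poly_growth_bound U g : locally_bounded_on U g -> poly_growth_on U g ->
  exists (k : nat) (C : R), 0 <= C /\ forall x, U x -> `|g x| <= C * bracket2 x ^+ k.
Proof.
move=> lbg [k [C [M gM]]]; have [B gB] := lbg M.
exists k, (`|C| + `|B|); split; first by rewrite addr_ge0.
move=> x Ux.
have N1 : 1 <= bracket2 x ^+ k by rewrite exprn_ege1// bracket2_ge1.
rewrite mulrDl; have [Mx|xM] := leP M (enorm x).
  apply: le_trans (gM _ Ux Mx) _.
  apply: (@le_trans _ _ (`|C| * bracket2 x ^+ k)); last first.
    by rewrite lerDl mulr_ge0// (le_trans ler01).
  apply: (@le_trans _ _ (`|C| * enorm x ^+ k)).
    by rewrite ler_wpM2r ?ler_norm// exprn_ge0// enorm_ge0.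
  rewrite ler_wpM2l//; apply: lerXn2r; rewrite ?nnegrE ?enorm_ge0 ?(ltW (bracket2_gt0 x))//.
  rewrite bracket2E.
  by have := sqr_ge0 (enorm x - 1); have := enorm_ge0 x; nra.
apply: le_trans (gB _ Ux (ltW xM)) _.
apply: (@le_trans _ _ `|B|); first exact: ler_norm.
apply: (@le_trans _ _ (`|B| * bracket2 x ^+ k)); first by rewrite ler_peMr.
by rewrite lerDr mulr_ge0// (le_trans ler01).
Qed.

(** The square root of the density exp (- V). *)
Definition half_root V x : R := expR (- V x / 2).

Lemma half_root_ge0 V x : 0 <= half_root V x.
Proof. exact: expR_ge0. Qed.

Lemma half_root_sqr V x : half_root V x ^+ 2 = expR (- V x).
Proof. by rewrite /half_root -expRM_natl; congr expR; field. Qed.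

(** Far from the origin, exp V dominates bracket2^(2 m); near the
    origin V is bounded. *)
Lemma half_root_decay U V : locally_bounded_on U V ->
  superpoly_growth_on U (fun x => expR (V x)) ->
  forall m : nat, exists C : R, 0 <= C /\
    forall x, U x -> half_root V x * bracket2 x ^+ m <= C.
Proof.
move=> lbV sV m; have [M VM] := sV (m * 4)%N (4 ^+ m).
pose M' := Num.max M 1.
have [B VB] := lbV M'.
exists (1 + expR (B / 2) * (1 + M' ^+ 2) ^+ m); split.
  rewrite addr_ge0// mulr_ge0 ?expR_ge0// exprn_ge0// addr_ge0// sqr_ge0.
  done.
move=> x Ux; have [M'x|xM'] := leP M' (enorm x).
  apply: ler_wpDr.
    by rewrite mulr_ge0 ?expR_ge0// exprn_ge0// addr_ge0// sqr_ge0.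
  rewrite -(@ler_pXn2r _ 2)// ?nnegrE ?mulr_ge0 ?half_root_ge0//; last first.
    by rewrite exprn_ge0// ltW// bracket2_gt0.
  rewrite expr1n exprMn half_root_sqr expRN mulrC ler_pdivrMr ?expR_gt0// mul1r.
  have Mx : M <= enorm x by apply: le_trans M'x; rewrite le_max lexx.
  have x1 : 1 <= enorm x by apply: le_trans M'x; rewrite le_max lexx orbT.
  apply: le_trans (VM _ Ux Mx).
  have e0 := enorm_ge0 x; have N0 := ltW (bracket2_gt0 x).
  have x2 : 1 <= enorm x ^+ 2 by rewrite exprn_ege1.
  rewrite mulnC exprM -exprMn -exprM mulnC exprM.
  (* 1 + e^2 <= 2 e^2 for e >= 1, squared *)
  have h : bracket2 x ^+ 2 <= 4 * enorm x ^+ 4.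
    rewrite bracket2E (_ : 4 * enorm x ^+ 4 = (2 * enorm x ^+ 2) ^+ 2); last by ring.
    by have := x2; set u := enorm x ^+ 2; nra.
  by apply: lerXn2r; rewrite ?nnegrE// ?exprn_ge0// (le_trans _ h)// exprn_ge0.
rewrite addrC; apply: ler_wpDr => //; apply: ler_pM; rewrite ?half_root_ge0//.
- by rewrite exprn_ge0// ltW// bracket2_gt0.
- rewrite /half_root ler_expR ler_wpM2r//.
  by apply: le_trans (VB _ Ux (ltW xM')); rewrite -normrN ler_norm.
- apply: lerXn2r; rewrite ?nnegrE ?(ltW (bracket2_gt0 x)) ?addr_ge0 ?sqr_ge0//.
  rewrite bracket2E lerD2l; apply: lerXn2r; rewrite ?nnegrE ?enorm_ge0 ?(ltW xM')//.
  by apply: le_trans (ltW xM'); exact: enorm_ge0.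
Qed.

Lemma weighted_decay U V g : locally_bounded_on U V ->
  superpoly_growth_on U (fun x => expR (V x)) ->
  locally_bounded_on U g -> poly_growth_on U g ->
  forall m : nat, exists C : R, 0 <= C /\
    forall x, U x -> `|g x| * half_root V x * bracket2 x ^+ m <= C.
Proof.
move=> lbV sV lbg pg m.
have [k [C [C0 gC]]] := poly_growth_bound lbg pg.
have [C' [C'0 VC']] := half_root_decay lbV sV (k + m)%N.
exists (C * C'); split; first by rewrite mulr_ge0.
move=> x Ux.
have N0 n : 0 <= bracket2 x ^+ n by rewrite exprn_ge0// ltW// bracket2_gt0.
apply: (@le_trans _ _ (C * bracket2 x ^+ k * half_root V x * bracket2 x ^+ m)).
  by rewrite !ler_wpM2r ?half_root_ge0// gC.
rewrite -!mulrA ler_wpM2l//; apply: le_trans (VC' _ Ux).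
by rewrite exprD mulrCA.
Qed.

End potential.

(** * Lipschitz bounds along dilations *)

Section scaling.
Context {R : realType} {d : nat}.
Implicit Types (U : set 'rV[R]_d) (g V : 'rV[R]_d -> R) (x y : 'rV[R]_d)
  (c : 'I_d -> R).

(** Dilations are performed one coordinate at a time, so that only partial
    derivatives enter. *)
Definition coord_scale c x : 'rV[R]_d := \row_i (c i * x 0 i).

Definition set_coord c i s : 'I_d -> R := fun j => if j == i then s else c j.

Lemma coord_scale_set_coord c i s s0 x :
  coord_scale (set_coord c i s) x =
  ((s - s0) * x 0 i) *: delta_mx 0 i + coord_scale (set_coord c i s0) x.
Proof.
apply/rowP => j; rewrite !mxE /= /set_coord.
by case: eqP => [->|_] /=; [ring|rewrite mulr0 add0r].
Qed.

Lemma bracket2_coord_scale c x : (forall i, 2^-1 <= c i) ->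
  bracket2 x <= 4 * bracket2 (coord_scale c x).
Proof.
move=> c2; rewrite /bracket2 mulrDr mulr1; apply: lerD; first by rewrite ler1n.
rewrite mulr_sumr; apply: ler_sum => i _; rewrite mxE exprMn.
have := c2 i; have := sqr_ge0 (x 0 i); set u := c i; set v := x 0 i ^+ 2.
move=> v0 u2; have u4 : 1 <= 4 * u ^+ 2 by nra.
by rewrite mulrA ler_peMl.
Qed.

Lemma is_derive_coord_scale V c i s x :
  derivable V (coord_scale (set_coord c i s) x) (delta_mx 0 i) ->
  is_derive s 1 (fun u => V (coord_scale (set_coord c i u) x))
    (partial i V (coord_scale (set_coord c i s) x) * x 0 i).
Proof.
set y := coord_scale (set_coord c i s) x => dV.
pose W (r : R) := V (r *: delta_mx 0 i + y).
have dW : is_derive (0 : R) 1 W (partial i V y).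
  have E : (fun h => h^-1 *: ((W \o shift 0) (h *: 1) - W 0)) =
      (fun h => h^-1 *: ((V \o shift y) (h *: delta_mx 0 i) - V y)).
    apply/funext => h; congr (_ *: (_ - _)); last by rewrite /W scale0r add0r.
    by rewrite /W /= addr0 [h *: 1]mulr1.
  by split; rewrite /derivable /partial /derive E.
have -> : (fun u => V (coord_scale (set_coord c i u) x)) =
    W \o (fun u => (u - s) * x 0 i).
  by apply/funext => u; rewrite /W /= (coord_scale_set_coord c i u s).
apply: is_derive1_comp.
  by rewrite subrr mul0r.
apply: is_derive_eq.
by rewrite /= ?scaler0 ?addr0 ?subr0 ?add0r ?oppr0 [_ *: _]mulr1 ?mulr1.
Qed.

End scaling.

Section root_lipschitz.
Context {R : realType} {d : nat} (U : set 'rV[R]_d) (V : 'rV[R]_d -> R).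
Context (Uscale : forall (c : 'I_d -> R) x,
  U x -> (forall i, 0 < c i) -> U (coord_scale c x)).
Context (dV : forall x i, U x -> derivable V x (delta_mx 0 i)).
Context (lbV : locally_bounded_on U V).
Context (sV : superpoly_growth_on U (fun x => expR (V x))).
Context (lbdV : forall i, locally_bounded_on U (partial i V)).
Context (pdV : forall i, poly_growth_on U (partial i V)).

(** Mean value theorem on the segment that scales the i-th coordinate by a
    factor in [t, 1].  Along it the bracket is at least a quarter of its initial
    value, so the decay of the derivative can be read at the initial point; the
    factor x_i of the derivative costs one power of the bracket. *)
Lemma half_root_coord_lipschitz m (i : 'I_d) : exists C : R, 0 <= C /\
  forall (c : 'I_d -> R) (t : R) x, U x -> (forall j, 2^-1 <= c j <= 1) ->
    2^-1 <= t <= 1 ->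
    `|half_root V (coord_scale (set_coord c i 1) x) -
      half_root V (coord_scale (set_coord c i t) x)| * bracket2 x ^+ m <= (1 - t) * C.
Proof.
have [C [C0 VC]] := weighted_decay lbV sV (lbdV i) (pdV i) m.+1.
exists (4 ^+ m.+1 * C); split; first by rewrite mulr_ge0// exprn_ge0.
move=> c t x Ux c21 /andP[t2 t1].
pose G s := half_root V (coord_scale (set_coord c i s) x).
have c0 (s : R) : 0 < s -> forall j, 0 < set_coord c i s j.
  move=> s0 j; rewrite /set_coord; case: eqP => // _.
  by have /andP[+ _] := c21 j; apply: lt_le_trans; rewrite invr_gt0.
have t0 : 0 < t by apply: lt_le_trans t2; rewrite invr_gt0.
have Us (s : R) : 0 < s -> U (coord_scale (set_coord c i s) x) by move=> s0; exact/Uscale/c0.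
have dG (s : R) : 0 < s -> is_derive s 1 G
    (G s * (- (partial i V (coord_scale (set_coord c i s) x) * x 0 i) / 2)).
  move=> s0.
  have := is_derive_coord_scale (@dV _ i (Us s s0)).
  set D := partial _ _ _ * _ => dVs.
  have -> : G = expR \o (fun u => - V (coord_scale (set_coord c i u) x) / 2).
    by apply/funext => u.
  apply: is_derive1_comp.
  have -> : (fun u : R => - V (coord_scale (set_coord c i u) x) / 2) =
      (- 2^-1) *: (fun u => V (coord_scale (set_coord c i u) x)).
    by apply/funext => u; rewrite -[RHS]/((- 2^-1) * V _); field.
  by apply: is_derive_eq; rewrite -[LHS]/((- 2^-1) * D); field.
have cG : {within `[t, 1], continuous G}.
  apply: derivable_within_continuous => r; rewrite in_itv/= => /andP[tr _].
  by case: (dG r (lt_le_trans t0 tr)).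
have dG' (s : R) : s \in `]t, 1[%R -> is_derive s 1 G
    (G s * (- (partial i V (coord_scale (set_coord c i s) x) * x 0 i) / 2)).
  by rewrite in_itv/= => /andP[ts _]; apply: dG; exact: lt_trans ts.
have [s] := MVT_segment t1 dG' cG.
rewrite in_itv/= => /andP[ts s1]; rewrite -/(G 1) -/(G t) => ->.
have s0 : 0 < s := lt_le_trans t0 ts.
set y := coord_scale _ _.
have Uy : U y by exact: Us.
have := VC _ Uy.
have Nxy : bracket2 x <= 4 * bracket2 y.
  apply: bracket2_coord_scale => j; rewrite /set_coord; case: eqP => _.
    exact: le_trans ts.
  by have /andP[] := c21 j.
have N0 := bracket2_gt0 x.
move=> VCy.
rewrite !normrM normrN normrM (ger0_norm (half_root_ge0 V y)).
rewrite [`|1 - t|]ger0_norm ?subr_ge0// [`|2^-1|]ger0_norm ?invr_ge0//.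
rewrite [leLHS](_ : _ = (1 - t) * (`|partial i V y| * half_root V y *
   (`|x 0 i| * bracket2 x ^+ m / 2))); last by ring.
rewrite ler_wpM2l ?subr_ge0//.
apply: (@le_trans _ _ (`|partial i V y| * half_root V y * (4 * bracket2 y) ^+ m.+1)).
  rewrite ler_wpM2l ?mulr_ge0 ?half_root_ge0//.
  apply: (@le_trans _ _ (bracket2 x ^+ m.+1)).
    rewrite exprS ler_pdivrMr//.
    have h : `|x 0 i| * bracket2 x ^+ m <= bracket2 x * bracket2 x ^+ m.
      by rewrite ler_wpM2r ?exprn_ge0// ?(ltW N0)// coord_le_bracket2.
    by apply: le_trans h _; rewrite ler_peMr ?mulr_ge0 ?exprn_ge0 ?(ltW N0)// ler1n.
  by apply: lerXn2r; rewrite ?nnegrE ?mulr_ge0 ?(ltW N0) ?(ltW (bracket2_gt0 y)).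
by rewrite exprMn mulrCA ler_wpM2l ?exprn_ge0.
Qed.

(** Telescoping over the coordinates. *)
Lemma half_root_scale_lipschitz m : exists C : R, 0 <= C /\
  forall (t : R) x, U x -> 2^-1 <= t <= 1 ->
    `|half_root V x - half_root V (t *: x)| * bracket2 x ^+ m <= (1 - t) * C.
Proof.
have /choice[C hC] := half_root_coord_lipschitz m.
exists (\sum_i C i); split; first by apply: sumr_ge0 => i _; have [] := hC i.
move=> t x Ux t21.
(* after k steps the coordinates below k are scaled *)
pose c k (j : 'I_d) : R := if (j < k)%N then t else 1.
pose G k := half_root V (coord_scale (c k) x).
have -> : half_root V x - half_root V (t *: x) = \sum_(i < d) (G i - G i.+1).
  rewrite -(big_mkord xpredT (fun i => G i - G i.+1)).
  have -> : \sum_(0 <= i < d) (G i - G i.+1) = - \sum_(0 <= i < d) (G i.+1 - G i).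
    by rewrite -sumrN; apply: eq_bigr => i _; rewrite opprB.
  rewrite telescope_sumr// opprB; congr (_ - _); congr half_root.
    by apply/rowP => j; rewrite !mxE /c mul1r.
  by apply/rowP => j; rewrite !mxE /c ltn_ord.
apply: (@le_trans _ _ (\sum_(i < d) (`|G i - G i.+1| * bracket2 x ^+ m))).
  rewrite -mulr_suml ler_wpM2r ?ler_norm_sum//.
  by rewrite exprn_ge0// ltW// bracket2_gt0.
rewrite mulr_sumr; apply: ler_sum => i _.
have [_ /(_ (c i) t x Ux)] := hC i.
have -> : set_coord (c i) i 1 = c i.
  by apply/funext => j; rewrite /set_coord /c; case: eqP => // ->; rewrite ltnn.
have -> : set_coord (c i) i t = c i.+1.
  apply/funext => j; rewrite /set_coord /c ltnS [(j <= i)%N]leq_eqVlt.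
  by rewrite -[in LHS]val_eqE /=; case: eqP.
apply=> // j; rewrite /c; case: ifP => // _.
by rewrite lexx andbT invf_le1// ler1n.
Qed.

Lemma sqrt_expr_lipschitz (n : nat) (t : R) : 0 <= t <= 1 ->
  0 <= 1 - Num.sqrt (t ^+ n) <= (1 - t) * n%:R.
Proof.
move=> /andP[t0 t1].
have h0 : 0 <= t ^+ n by rewrite exprn_ge0.
have h1 : t ^+ n <= 1 by rewrite exprn_ile1.
have h2 : 1 - t ^+ n <= (1 - t) * n%:R.
  elim: n {h0 h1} => [|n IH]; first by rewrite expr0 subrr mulr0.
  rewrite exprS -natr1.
  by have := exprn_ge0 n t0; have := exprn_ile1 n t0 t1; nra.
have s0 := sqrtr_ge0 (t ^+ n); have s2 := sqr_sqrtr h0.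
have s1 : Num.sqrt (t ^+ n) <= 1 by rewrite -sqrtr1 ler_wsqrtr.
by apply/andP; split; nra.
Qed.

(** The factor sqrt (t^d) normalizes the dilated density; it is within d (1 - t)
    of 1. *)
Lemma half_root_dilation_lipschitz m : exists C : R, 0 <= C /\
  forall (t : R) x, U x -> 2^-1 <= t <= 1 ->
    `|Num.sqrt (t ^+ d) * half_root V (t *: x) - half_root V x| * bracket2 x ^+ m
      <= (1 - t) * C.
Proof.
have [C [C0 hC]] := half_root_scale_lipschitz m.
have [C' [C'0 VC']] := half_root_decay lbV sV m.
exists (d%:R * (4 ^+ m * C') + C); split.
  by rewrite addr_ge0// !mulr_ge0// exprn_ge0.
move=> t x Ux t21; have /andP[t2 t1] := t21.
have t0 : 0 < t by apply: lt_le_trans t2; rewrite invr_gt0.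
have txE : t *: x = coord_scale (fun=> t) x by apply/rowP => j; rewrite !mxE.
have Utx : U (t *: x) by rewrite txE; apply: Uscale.
have /andP[q0 q1] : 0 <= 1 - Num.sqrt (t ^+ d) <= (1 - t) * d%:R.
  by apply: sqrt_expr_lipschitz; rewrite ltW.
have Nx0 : 0 <= bracket2 x ^+ m by rewrite exprn_ge0// ltW// bracket2_gt0.
have -> : Num.sqrt (t ^+ d) * half_root V (t *: x) - half_root V x =
  - ((1 - Num.sqrt (t ^+ d)) * half_root V (t *: x)) -
    (half_root V x - half_root V (t *: x)) by ring.
apply: le_trans (ler_wpM2r Nx0 (ler_normB _ _)) _.
rewrite mulrDl mulrDr; apply: lerD; last exact: hC.
rewrite normrN normrM (ger0_norm q0) (ger0_norm (half_root_ge0 _ _)) -mulrA.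
rewrite [leRHS]mulrA; apply: ler_pM => //.
  by rewrite mulr_ge0 ?half_root_ge0.
apply: (@le_trans _ _ (half_root V (t *: x) * (4 * bracket2 (t *: x)) ^+ m)).
  rewrite ler_wpM2l ?half_root_ge0//; apply: lerXn2r.
  - by rewrite nnegrE ltW// bracket2_gt0.
  - by rewrite nnegrE mulr_ge0// ltW// bracket2_gt0.
  - by rewrite txE; exact: bracket2_coord_scale.
by rewrite exprMn mulrCA ler_wpM2l ?exprn_ge0// VC'.
Qed.

End root_lipschitz.

(** * Square roots of the densities of the two classes *)

Section density_roots.
Context {R : realType} {d : nat}.
Implicit Types (U : set 'rV[R]_d) (p V : 'rV[R]_d -> R) (f : d.-tuple R -> R).

(** The square root of the density of the points multiplied by 1 / t, when f is
    that of the points. *)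
Definition dilated f (t : R) (x : d.-tuple R) : R :=
  Num.sqrt (t ^+ d) * f (scale_tuple t x).

(** What the fluctuation argument uses of the density p: a square root f, up to
    a null set, that is bounded and whose squared Hellinger distance to its
    dilates is O((1 - t)^2). *)
Definition regular_root p f := 
  [/\ measurable_fun [set: d.-tuple R] f,
      forall x, 0 <= f x,
      exists K : R, forall x, f x <= K,
      forall A : set (d.-tuple R), measurable A ->
        (\int[lebesgue_tuple R d]_(x in A) (p (row_of_tuple x))%:E =
         \int[lebesgue_tuple R d]_(x in A) (f x ^+ 2)%:E)%E &
      exists C : R, 0 <= C /\ forall t : R, 2^-1 <= t <= 1 ->
        (\int[lebesgue_tuple R d]_x ((dilated f t x - f x) ^+ 2)%:E
           <= (C * (1 - t) ^+ 2)%:E)%E].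

Lemma measurable_dilated f t : measurable_fun [set: d.-tuple R] f ->
  measurable_fun [set: d.-tuple R] (dilated f t).
Proof.
move=> mf; apply: measurable_funM => //.
by apply: measurableT_comp => //; exact: measurable_scale_tuple.
Qed.

Lemma prod_oneDsqr_le (x : 'rV[R]_d) :
  \prod_i (1 + x 0 i ^+ 2) <= bracket2 x ^+ d.
Proof.
rewrite -[X in _ <= _ ^+ X]card_ord -prodr_const; apply: ler_prod => i _.
rewrite addr_ge0 ?sqr_ge0//= lerD2l (bigD1 i)//= lerDl.
by apply: sumr_ge0 => j _; exact: sqr_ge0.
Qed.

(** The pointwise bound (1 - t) C / bracket2^d on g - f is square integrable
    because bracket2^d dominates the product of the 1 + x_i^2.  Where U fails,
    it fails along the whole dilation orbit, and f and g both vanish. *)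
Lemma potential_regular_root U p V :
  (forall (c : 'I_d -> R) x, U x -> (forall i, 0 < c i) -> U (coord_scale c x)) ->
  (forall x i, U x -> derivable V x (delta_mx 0 i)) ->
  locally_bounded_on U V ->
  superpoly_growth_on U (fun x => expR (V x)) ->
  (forall i, locally_bounded_on U (partial i V)) ->
  (forall i, poly_growth_on U (partial i V)) ->
  (forall x, U x -> p x = expR (- V x)) ->
  measurable [set t | U (row_of_tuple t)] ->
  (lebesgue_tuple R d).-negligible
    [set t | ~ U (row_of_tuple t) /\ p (row_of_tuple t) <> 0] ->
  measurable_fun [set: d.-tuple R] (p \o @row_of_tuple R d) ->
  (forall x, 0 <= p x) ->
  exists f, regular_root p f.
Proof.
move=> Uscale dV lbV sV lbdV pdV pV mU nU mp p0.
pose f t := if `[< U (row_of_tuple t) >] then half_root V (row_of_tuple t) else 0.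
have fE : f = (fun t => Num.sqrt (p (row_of_tuple t)) * \1_[set t | U (row_of_tuple t)] t).
  apply/funext => t; rewrite /f indicE; case: asboolP => Ut.
    by rewrite mem_set// mulr1 pV// -half_root_sqr sqrtr_sqr ger0_norm// half_root_ge0.
  by rewrite memNset// mulr0.
have f0 t : 0 <= f t by rewrite /f; case: ifP => // _; exact: half_root_ge0.
have mf : measurable_fun [set: d.-tuple R] f.
  rewrite fE; apply: measurable_funM => //.
  apply: (measurableT_comp (f := @Num.sqrt R)) => //.
  by apply: continuous_measurable_fun; exact: sqrt_continuous.
exists f; split=> //.
- have [C [C0 hC]] := half_root_decay lbV sV 0.
  exists C => x; rewrite /f; case: asboolP => // Ux.
  by have := hC _ Ux; rewrite expr0 mulr1.
- move=> A mA; apply: ge0_ae_eq_integral => //.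
  + by apply: measurable_funTS; exact/measurable_EFinP.
  + by apply: measurable_funTS; apply/measurable_EFinP; exact: measurable_funX.
  + by move=> x _; rewrite lee_fin.
  + by move=> x _; rewrite lee_fin; exact: sqr_ge0.
  + apply: negligibleS nU => x /= /not_implyP[_].
    rewrite /f; case: asboolP => Ux; first by rewrite half_root_sqr pV.
    by rewrite expr0n/= => h; split=> // px; apply: h; rewrite px.
- have [C [C0 hC]] := half_root_dilation_lipschitz Uscale dV lbV sV lbdV pdV d.
  have Ifin := @integral_tuple_oneDsqrV R d.
  set I : \bar R := (\int[lebesgue_tuple R d]_t _)%E in Ifin.
  have P0 (t : d.-tuple R) : 0 <= \prod_i (1 + tnth t i ^+ 2)^-1.
    by apply: prodr_ge0 => i _; rewrite invr_ge0 addr_ge0// sqr_ge0.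
  have I0 : (0 <= I)%E by apply: integral_ge0 => x _; rewrite lee_fin.
  exists (C ^+ 2 * fine I); split; first by rewrite mulr_ge0 ?sqr_ge0// fine_ge0.
  move=> t t21.
  have mP : measurable_fun [set: d.-tuple R]
      (fun x => (\prod_i (1 + tnth x i ^+ 2)^-1)%:E).
    apply/measurable_EFinP; apply: measurable_prod => i _.
    apply: (measurableT_comp (f := fun u : R => (1 + u ^+ 2)^-1)).
      by apply: continuous_measurable_fun; exact: continuous_oneDsqrV.
    exact: measurable_tnth.
  have PE0 (x : d.-tuple R) : setT x -> (0 <= (\prod_i (1 + tnth x i ^+ 2)^-1)%:E)%E.
    by rewrite lee_fin.
  have c0 : (0 <= (C ^+ 2 * (1 - t) ^+ 2)%:E)%E.
    by rewrite lee_fin mulr_ge0// sqr_ge0.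
  apply: (@le_trans _ _ (\int[lebesgue_tuple R d]_x
     ((C ^+ 2 * (1 - t) ^+ 2)%:E * (\prod_i (1 + tnth x i ^+ 2)^-1)%:E))%E); last first.
    rewrite ge0_integralZl// -/I.
    have -> : I = (fine I)%:E by rewrite fineK// ge0_fin_numE.
    by rewrite -EFinM lee_fin mulrAC.
  apply: ge0_le_integral => //.
  + by move=> x _; rewrite lee_fin; exact: sqr_ge0.
  + apply/measurable_EFinP; apply: measurable_funX; apply: measurable_funB => //.
    exact: measurable_dilated.
  + exact: measurable_funeM.
  move=> x _; rewrite -EFinM lee_fin.
  have rowE : row_of_tuple (scale_tuple t x) = t *: row_of_tuple x.
    by apply/rowP => i; rewrite !mxE tnth_mktuple.
  have t0 : 0 < t by have /andP[+ _] := t21; apply: lt_le_trans; rewrite invr_gt0.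
  have txE y : t *: y = coord_scale (fun=> t) y by apply/rowP => j; rewrite !mxE.
  rewrite /dilated /f rowE.
  case: (asboolP (U (row_of_tuple x))) => Ux; last first.
    rewrite asboolF; last first.
      move=> Utx; apply: Ux.
      have := Uscale (fun=> t^-1) _ Utx; rewrite invr_gt0 => /(_ (fun=> t0)).
      congr U; apply/rowP => j; rewrite !mxE mulrA mulVf ?mul1r//.
      exact: lt0r_neq0.
    by rewrite mulr0 subrr expr0n/= mulr_ge0// ?mulr_ge0// sqr_ge0.
  rewrite asboolT; last by rewrite txE; apply: Uscale.
  have := hC t _ Ux t21.
  set b := (X in `|X|); set y := row_of_tuple x => hb.
  have Py : \prod_i (1 + tnth x i ^+ 2) <= bracket2 y ^+ d.
    have := prod_oneDsqr_le y.
    by under eq_bigr do rewrite mxE.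
  have PP : 0 < \prod_i (1 + tnth x i ^+ 2).
    by apply: prodr_gt0 => i _; rewrite ltr_pwDl// sqr_ge0.
  rewrite prodfV ler_pdivlMr//.
  have N1 : 1 <= bracket2 y ^+ d by rewrite exprn_ege1// bracket2_ge1.
  have N0 : 0 <= bracket2 y ^+ d by exact: le_trans N1.
  apply: (@le_trans _ _ ((`|b| * bracket2 y ^+ d) ^+ 2)).
    rewrite exprMn real_normK ?num_real// ler_wpM2l ?sqr_ge0//.
    by apply: le_trans Py _; rewrite expr2 ler_peMl.
  have hb0 : 0 <= `|b| * bracket2 y ^+ d by rewrite mulr_ge0.
  rewrite -exprMn [C * _]mulrC; apply: lerXn2r => //.
  by rewrite nnegrE; exact: le_trans hb.
Qed.

Lemma class_P_regular_root p : class_P p -> exists f, regular_root p f.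
Proof.
move=> [[mp p0 _] [V [pV sV gV eV]]].
have bd g : continuous g -> locally_bounded_on [set: 'rV[R]_d] g.
  move=> cg; have := @continuous_locally_bounded R d setT g (@closedT _).
  have -> : [set x : 'rV[R]_d | forall i, setT (x 0 i)] = setT by apply/seteqP; split.
  by apply; exact: continuous_subspaceT.
apply: (potential_regular_root (U := setT) (V := V)) => //.
- by move=> x i _; have [_] := sV [::] x I; exact.
- by apply: bd => x; have [] := sV [::] x I.
- by move=> i; apply: bd => x; have [] := sV [:: i] x I.
- by move=> i; exact: (gV [:: i]).
- by rewrite (_ : [set t | _] = setT)//; apply/seteqP; split.
- rewrite (_ : [set t | _] = set0); first exact: negligible_set0.
  by apply/seteqP; split=> // t [/= h _]; exact: (h I).
Qed.

(** The potential is only controlled in the open orthant; the boundary, where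
    the density may be positive, lies in a union of coordinate hyperplanes. *)
Lemma class_Pplus_regular_root p : class_Pplus p -> exists f, regular_root p f.
Proof.
move=> [[mp p0 _] [V [pV pN [sV cV] gV eV]]].
have bd g : {within @nonneg_orthant R d, continuous g} ->
    locally_bounded_on (@pos_orthant R d) g.
  move=> cg M.
  have [B gB] := @continuous_locally_bounded R d [set x | 0 <= x] g (@closed_ge _ 0) cg M.
  by exists B => x Ux; apply: gB => i; exact: ltW.
apply: (potential_regular_root (U := @pos_orthant R d) (V := V)) => //.
- by move=> c x Ux c0 i; rewrite mxE mulr_gt0// Ux.
- by move=> x i Ux; have [_] := sV [::] x Ux; exact.
- exact: bd.
- move=> i; have [_ [g cg gE]] := gV [:: i].
  move=> M; have [B gB] := bd _ cg M; exists B => x Ux xM.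
  by have := gB _ Ux xM; rewrite gE.
- by move=> i; have [] := gV [:: i].
- by move=> x Ux; apply: pV => i; exact/ltW/Ux.
- rewrite [X in measurable X](_ : _ = box (fun=> `]0, +oo[%classic : set R)).
    by apply: measurable_box.
  by apply/seteqP; split=> t h i; have := h i; rewrite mxE/= in_itv/= andbT.
- pose F (k : nat) : set (d.-tuple R) :=
    if insub k is Some i then [set t | tnth t i = 0] else set0.
  apply: (negligibleS (A := \bigcup_k F k)).
    move=> t [/= nU pt].
    have nn : nonneg_orthant (row_of_tuple t) by apply: contrapT => /pN.
    have /existsNP[i /negP ti] := nU.
    exists (val i) => //; rewrite /F valK /=.
    have := nn i; move: ti; rewrite mxE -leNgt => h1 h2.
    by apply/eqP; rewrite eq_le h1.
  apply: negligible_bigcup => k; rewrite /F; case: insubP => [i _ _|_]; last first.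
    exact: negligible_set0.
  apply/negligibleP; last exact: lebesgue_tuple_hyperplane.
  have := @measurable_tnth _ R _ i measurableT [set 0] (measurable_set1 0).
  by rewrite setTI.
Qed.

End density_roots.

(** * Tours and matchings *)

Section functionals.
Context {R : realType} {d : nat}.

Lemma enormZ c (x : 'rV[R]_d) : 0 <= c -> enorm (c *: x) = c * enorm x.
Proof.
move=> c0; rewrite /enorm -[in RHS](ger0_norm c0) -sqrtr_sqr -sqrtrM ?sqr_ge0//.
by rewrite mulr_sumr; congr Num.sqrt; apply: eq_bigr => i _; rewrite mxE exprMn.
Qed.

Lemma enormN (x : 'rV[R]_d) : enorm (- x) = enorm x.
Proof. by congr Num.sqrt; apply: eq_bigr => i _; rewrite mxE sqrrN. Qed.

Definition points_of n (s : n.-tuple (d.-tuple R)) (i : 'I_n) : 'rV[R]_d :=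
  row_of_tuple (tnth s i).

Lemma measurable_enorm_sub disp (T : measurableType disp) (a b : T -> d.-tuple R) :
  measurable_fun [set: T] a -> measurable_fun [set: T] b ->
  measurable_fun [set: T] (fun x => enorm (row_of_tuple (a x) - row_of_tuple (b x))).
Proof.
move=> ma mb; apply: (measurableT_comp (f := @Num.sqrt R)).
  by apply: continuous_measurable_fun; exact: sqrt_continuous.
apply: measurable_sum => k.
rewrite (_ : (fun _ => _) = (fun x => (tnth (a x) k - tnth (b x) k) ^+ 2)).
  apply: measurable_funX; apply: measurable_funB.
    exact: (measurableT_comp (measurable_tnth k) ma).
  exact: (measurableT_comp (measurable_tnth k) mb).
by apply/funext => x; rewrite !mxE.
Qed.

Lemma measurable_distance n (i j : 'I_n) :
  measurable_fun [set: n.-tuple (d.-tuple R)]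
    (fun s => enorm (points_of s i - points_of s j)).
Proof. by apply: measurable_enorm_sub; exact: measurable_tnth. Qed.

Definition r_isolated n (x : 'I_n -> 'rV[R]_d) (r : R) (i : 'I_n) : bool :=
  [forall j, (j != i) ==> (r <= enorm (x i - x j))].

(** The properties shared by tours and matchings.  The last one bounds F from
    below by the number of r-isolated points, each of which is an endpoint of an
    edge of length at least r; k accounts for edges counted at both ends. *)
Record spread_functional n (F : ('I_n -> 'rV[R]_d) -> R) (k : R) : Prop :=
 SpreadFunctional {
  measurable_spread :
    measurable_fun [set: n.-tuple (d.-tuple R)] (fun s => F (points_of s));
  spread_homogeneous : forall c x, 0 < c -> F (fun i => c *: x i) = c * F x;
  spread_isolated : forall x r, 0 <= r -> r * #|r_isolated x r|%:R <= k * F x }.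

Lemma measurable_bigmin disp (T : measurableType disp) (I : Type) (s : seq I)
    (Q : pred I) (f0 : T -> R) (f : I -> T -> R) :
  measurable_fun [set: T] f0 -> (forall i, measurable_fun [set: T] (f i)) ->
  measurable_fun [set: T] (fun x => \big[Num.min/f0 x]_(i <- s | Q i) f i x).
Proof.
move=> mf0 mf; elim: s => [|i s IH].
  by rewrite (_ : (fun _ => _) = f0)//; apply/funext => x; rewrite big_nil.
case: (boolP (Q i)) => Qi.
  rewrite (_ : (fun _ => _) = (fun x =>
      Num.min (f i x) (\big[Num.min/f0 x]_(j <- s | Q j) f j x))).
    exact: measurable_minr.
  by apply/funext => x; rewrite big_cons Qi.
rewrite (_ : (fun _ => _) = (fun x => \big[Num.min/f0 x]_(j <- s | Q j) f j x))//.
by apply/funext => x; rewrite big_cons (negbTE Qi).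
Qed.

Lemma isolated_sum n (x : 'I_n -> 'rV[R]_d) (r : R) (g : 'I_n -> 'I_n) :
  0 <= r -> (forall i, g i != i) ->
  r * #|r_isolated x r|%:R <= \sum_i enorm (x i - x (g i)).
Proof.
move=> r0 gi; rewrite mulr_natr -sumr_const big_mkcond/=.
apply: ler_sum => i _; case: ifPn => [/forallP/(_ (g i))|_]; last exact: sqrtr_ge0.
by rewrite gi.
Qed.

Lemma tour_lengthZ n (x : 'I_n -> 'rV[R]_d) c pi : 0 <= c ->
  tour_length (fun i => c *: x i) pi = c * tour_length x pi.
Proof.
by move=> c0; rewrite mulr_sumr; apply: eq_bigr => i _; rewrite -scalerBr enormZ.
Qed.

Lemma tsp_spread n : (1 < n)%N -> spread_functional (@tsp_length R d n) 1.
Proof.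
move=> n1; split.
- apply: measurable_bigmin => [|pi];
    by apply: measurable_sum => i; exact: measurable_distance.
- move=> c x c0.
  have [[pi piE] le] := tsp_lengthP x.
  have [[pi' piE'] le'] := tsp_lengthP (fun i => c *: x i).
  apply/eqP; rewrite eq_le; apply/andP; split.
    by rewrite piE -tour_lengthZ ?(ltW c0)// le'.
  by rewrite piE' tour_lengthZ ?(ltW c0)// ler_pM2l.
- move=> x r r0; rewrite mul1r.
  have [[pi ->] _] := tsp_lengthP x.
  rewrite /tour_length (reindex_inj (@perm_inj _ (pi^-1)%g))/=.
  under eq_bigr do rewrite permKV.
  apply: isolated_sum => // i.
  rewrite -{2}(permKV pi i) (inj_eq perm_inj).
  (* the cyclic successor of j differs from j because n > 1 *)
  rewrite -val_eqE /=; set j := (pi^-1)%g i; have jn := ltn_ord j.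
  have [jn1|jn1] := eqVneq (j.+1) n; first by rewrite jn1 modnn; lia.
  by rewrite modn_small; lia.
Qed.

Lemma matching_lengthZ n (x : 'I_n -> 'rV[R]_d) c Q : 0 <= c ->
  matching_length (fun i => c *: x i) Q = c * matching_length x Q.
Proof.
move=> c0; rewrite /matching_length mulr_sumr; apply: eq_bigr => i _.
rewrite mulr_sumr; apply: eq_bigr => j _.
by rewrite -scalerBr enormZ.
Qed.

Lemma perfect_matching_partner n (Q : {set {set 'I_n}}) :
  perfect_matching Q -> exists g : 'I_n -> 'I_n,
    forall i, g i != i /\ [set i; g i]%SET \in Q.
Proof.
move=> /andP[/and3P[/eqP cQ tQ _] /forall_inP c2].
suff h : forall i, exists j, j != i /\ [set i; j]%SET \in Q.
  by have [g gP] := choice h; exists g.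
move=> i.
have : i \in finset.cover Q by rewrite cQ inE.
move=> /finset.bigcupP[B BQ iB].
have /cards2P[a [b [ab BE]]] := c2 B BQ.
move: iB BQ; rewrite BE !inE => /orP[/eqP ->|/eqP ->] BQ.
  by exists b; rewrite eq_sym.
by exists a; split => //; rewrite finset.setUC.
Qed.

(** Summing over ordered pairs counts each edge of the matching twice, and
    bounds from below the sum over all points of the distance to the partner. *)
Lemma matching_length_isolated n (x : 'I_n -> 'rV[R]_d) (r : R) Q :
  0 <= r -> perfect_matching Q ->
  r * #|r_isolated x r|%:R <= 2 * matching_length x Q.
Proof.
move=> r0 /perfect_matching_partner[g gP].
have := isolated_sum x r0 (fun i => (gP i).1); move=> /le_trans; apply.
pose a i j : R := if [set i; j]%SET \in Q then enorm (x i - x j) else 0.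
have aC i j : a i j = a j i.
  by rewrite /a finset.setUC; case: ifP => // _; rewrite -enormN opprB.
have a0 i j : 0 <= a i j by rewrite /a; case: ifP => // _; exact: sqrtr_ge0.
have mE : matching_length x Q = \sum_(i < n) \sum_(j < n) (if (i < j)%N then a i j else 0).
  apply: eq_bigr => i _; rewrite big_mkcond/=; apply: eq_bigr => j _.
  by rewrite /a; case: (_ < _)%N; case: (_ \in _).
have -> : 2 * matching_length x Q =
    \sum_(i < n) \sum_(j < n) (if (i < j)%N then a i j else if (j < i)%N then a i j else 0).
  rewrite mulr_natl mulr2n {2}mE exchange_big/= mE -big_split/=.
  apply: eq_bigr => i _; rewrite -big_split/=; apply: eq_bigr => j _.
  by case: ltngtP => _; rewrite ?addr0 ?add0r// aC.
apply: ler_sum => i _; rewrite (bigD1 (g i))//=.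
have [gi giQ] := gP i.
rewrite [X in _ <= X + _](_ : _ = enorm (x i - x (g i))).
  by rewrite lerDl sumr_ge0// => j _; case: ifP => // _; case: ifP.
move: gi; rewrite -val_eqE /a giQ /=.
by case: ltngtP.
Qed.

Lemma measurable_matching_length n (Q : {set {set 'I_n}}) :
  measurable_fun [set: n.-tuple (d.-tuple R)]
    (fun s => matching_length (points_of s) Q).
Proof.
apply: measurable_sum => i; under eq_fun do rewrite big_mkcond.
apply: measurable_sum => j; case: ((i < j)%N && _) => //.
exact: measurable_distance.
Qed.

Lemma min_matching_spread n : ~~ odd n ->
  spread_functional (@min_matching_length R d n) 2.
Proof.
move=> en; split.
- have [P0 mP0] := exists_perfect_matching en.
  rewrite (_ : (fun _ => _) = (fun s : n.-tuple (d.-tuple R) =>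
     \big[Num.min/matching_length (points_of s) P0]_(Q : {set {set 'I_n}} | perfect_matching Q)
        matching_length (points_of s) Q)).
    by apply: measurable_bigmin => [|Q]; exact: measurable_matching_length.
  apply/funext => s.
  have [[Q mQ QE] le] := min_matching_lengthP (points_of s) en.
  apply/eqP; rewrite eq_le; apply/andP; split.
    by apply: le_bigmin => [|Q' mQ']; exact: le.
  by rewrite QE; exact: bigmin_le_cond.
- move=> c x c0.
  have [[Q mQ QE] le] := min_matching_lengthP x en.
  have [[Q' mQ' QE'] le'] := min_matching_lengthP (fun i => c *: x i) en.
  apply/eqP; rewrite eq_le; apply/andP; split.
    by rewrite QE -matching_lengthZ ?(ltW c0)// le'.
  by rewrite QE' matching_lengthZ ?(ltW c0)// ler_pM2l// le.
- move=> x r r0.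
  have [[Q mQ ->] _] := min_matching_lengthP x en.
  exact: matching_length_isolated.
Qed.

End functionals.

(** * The law of a dilated sample *)

Lemma measurable_ltr_set {R : realType} {disp} {T : measurableType disp}
    (h : T -> R) (r : R) :
  measurable_fun [set: T] h -> measurable [set x | h x < r].
Proof.
move=> mh; rewrite (_ : [set x | _] = setT `&` h @^-1` `]-oo, r[%classic).
  exact: mh.
by rewrite setTI; apply/seteqP; split=> x /=; rewrite in_itv.
Qed.

Section dilated_sample.
Context {R : realType} {disp} {T : measurableType disp} (P : probability T R)
  {d : nat}.
Implicit Types (X : nat -> {RV P >-> d.-tuple R}) (f : d.-tuple R -> R).
Let lambda := lebesgue_tuple R d.

Definition scaled_RV (c : R) (Z : T -> d.-tuple R) (w : T) : d.-tuple R :=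
  scale_tuple c (Z w).

Lemma measurable_scaled_RV c (Z : {RV P >-> d.-tuple R}) :
  measurable_fun [set: T] (scaled_RV c Z).
Proof. by apply: measurableT_comp => //; exact: measurable_scale_tuple. Qed.

HB.instance Definition _ c (Z : {RV P >-> d.-tuple R}) :=
  isMeasurableFun.Build _ _ _ _ (scaled_RV c Z) (measurable_scaled_RV c Z).

Definition scaled_seq c X : nat -> {RV P >-> d.-tuple R} :=
  fun i => scaled_RV c (X i).

Lemma scaled_independent c X :
  mutually_independent X -> mutually_independent (scaled_seq c X).
Proof.
move=> iX s A us mA.
have := iX s (fun i => scale_tuple c @^-1` A i) us; apply => i.
by rewrite -[_ @^-1` _]setTI; apply: measurable_scale_tuple.
Qed.

(** Change of variables: multiplication by 1 / t pushes Lebesgue measure forward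
    to t^d times itself. *)
Lemma scaled_root_density t X f : 0 < t -> measurable_fun [set: d.-tuple R] f ->
  root_density lambda f X ->
  root_density lambda (dilated f t) (scaled_seq t^-1 X).
Proof.
move=> t0 mf dX i B mB.
have mS := @measurable_scale_tuple R d t^-1.
have mSB : measurable (scale_tuple t^-1 @^-1` B).
  by rewrite -[_ @^-1` _]setTI; apply: mS.
have mh : measurable_fun [set: d.-tuple R] (fun y => (f (scale_tuple t y) ^+ 2)%:E).
  apply/measurable_EFinP; apply: measurable_funX.
  by apply: measurableT_comp => //; exact: measurable_scale_tuple.
have mhB : measurable_fun B (fun y => (f (scale_tuple t y) ^+ 2)%:E).
  exact: measurable_funTS.
transitivity (distribution P (X i) (scale_tuple t^-1 @^-1` B)); first by [].
rewrite (dX i _ mSB).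
transitivity (\int[lambda]_(x in scale_tuple t^-1 @^-1` B)
   ((fun y => (f (scale_tuple t y) ^+ 2)%:E) \o scale_tuple t^-1) x)%E.
  apply: eq_integral => x _ /=.
  by rewrite scale_tupleA divff ?lt0r_neq0// scale_tuple1.
have h0 y : (0 <= (f (scale_tuple t y) ^+ 2)%:E)%E by rewrite lee_fin sqr_ge0.
rewrite -(ge0_integral_pushforward mS)//.
have td0 : 0 <= t ^+ d by rewrite exprn_ge0// ltW.
transitivity (\int[mscale (NngNum td0) lambda]_(y in B) (f (scale_tuple t y) ^+ 2)%:E)%E.
  apply: eq_measure_integral => A mA _.
  rewrite /mscale /= /pushforward.
  by rewrite [LHS]lebesgue_tuple_scale ?invr_gt0// invrK.
rewrite ge0_integral_mscale//= -ge0_integralZl//.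
apply: eq_integral => y _; rewrite -EFinM; congr EFin.
by rewrite /dilated exprMn sqr_sqrtr.
Qed.

(** 2 f g + (g - f)^2 = f^2 + g^2, and both f^2 and g^2 have integral 1. *)
Lemma root_affinity t X f (e : R) : 0 < t -> measurable_fun [set: d.-tuple R] f ->
  (forall x, 0 <= f x) -> root_density lambda f X ->
  (\int[lambda]_x ((dilated f t x - f x) ^+ 2)%:E <= e%:E)%E ->
  ((1 - e / 2)%:E <= \int[lambda]_x (f x * dilated f t x)%:E)%E.
Proof.
move=> t0 mf f0 dX he.
have dY := scaled_root_density t0 mf dX.
have mg := measurable_dilated t mf.
set g := dilated f t in dY mg he *.
have g0 x : 0 <= g x by rewrite mulr_ge0// sqrtr_ge0.
have mE (h : d.-tuple R -> R) : measurable_fun setT h ->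
  measurable_fun [set: d.-tuple R] (EFin \o h) by move=> mh; exact/measurable_EFinP.
have mfg : measurable_fun [set: d.-tuple R] (fun x => (f x * g x)%:E).
  by apply: mE; exact: measurable_funM.
have mfg2 : measurable_fun [set: d.-tuple R] (fun x => ((g x - f x) ^+ 2)%:E).
  by apply: mE; apply: measurable_funX; exact: measurable_funB.
have mf2 : measurable_fun [set: d.-tuple R] (fun x => (f x ^+ 2)%:E).
  by apply: mE; exact: measurable_funX.
have mg2 : measurable_fun [set: d.-tuple R] (fun x => (g x ^+ 2)%:E).
  by apply: mE; exact: measurable_funX.
have m2fg : measurable_fun [set: d.-tuple R] (fun x => 2%:E * (f x * g x)%:E)%E.
  exact: measurable_funeM.
have fg0 x : setT x -> (0 <= (f x * g x)%:E)%E by rewrite lee_fin mulr_ge0.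
have fg20 x : setT x -> (0 <= ((g x - f x) ^+ 2)%:E)%E by rewrite lee_fin sqr_ge0.
have f20 x : setT x -> (0 <= (f x ^+ 2)%:E)%E by rewrite lee_fin sqr_ge0.
have g20 x : setT x -> (0 <= (g x ^+ 2)%:E)%E by rewrite lee_fin sqr_ge0.
have fg20' x : setT x -> (0 <= 2%:E * (f x * g x)%:E)%E.
  by move=> _; rewrite mule_ge0// lee_fin mulr_ge0.
have If : (\int[lambda]_x (f x ^+ 2)%:E = 1)%E.
  by rewrite -(dX 0%N setT measurableT) probability_setT.
have Ig : (\int[lambda]_x (g x ^+ 2)%:E = 1)%E.
  by rewrite -(dY 0%N setT measurableT) probability_setT.
have : (2%:E * \int[lambda]_x (f x * g x)%:E +
        \int[lambda]_x ((g x - f x) ^+ 2)%:E = 1 + 1)%E.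
  rewrite -ge0_integralZl// -ge0_integralD// -[X in (X + _)%E]If -[X in (_ + X)%E]Ig.
  rewrite -ge0_integralD//; apply: eq_integral => x _.
  by rewrite -EFinM -!EFinD; congr EFin; ring.
set a := (\int[lambda]_x (f x * g x)%:E)%E.
have a0 : (0 <= a)%E by exact: integral_ge0.
move: he; set b := integral _ _ _.
have b0 : (0 <= b)%E by exact: integral_ge0.
move: a a0 => [a| |] a0; last by [].
  move: b b0 => [b| |] // b0; rewrite !lee_fin => be.
  by rewrite -EFinM -!EFinD => -[] h; lra.
by move=> _ _; rewrite leey.
Qed.

End dilated_sample.

(** * Close pairs and the typical size of a functional *)

Section close_pairs.
Context {R : realType} {disp} {T : measurableType disp} (P : probability T R)
  {d : nat}.
Implicit Types (X : nat -> {RV P >-> d.-tuple R}) (f : d.-tuple R -> R).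
Local Notation lambda := (lebesgue_tuple R d).

Lemma ball_probability X f (K r : R) i (x : d.-tuple R) :
  measurable_fun [set: d.-tuple R] f -> (forall y, 0 <= f y <= K) -> 0 <= r ->
  root_density lambda f X ->
  (distribution P (X i) [set y | (enorm (row_of_tuple x - row_of_tuple y) < r)%R]
    <= (K ^+ 2 * (2 * r) ^+ d)%:E)%E.
Proof.
move=> mf fK r0 dX.
pose B : set (d.-tuple R) := box (fun i => `[tnth x i - r, tnth x i + r]%classic : set R).
have mB : measurable B by exact: measurable_box.
apply: (@le_trans _ _ (distribution P (X i) B)).
  apply: le_measure; rewrite ?inE//.
    apply: measurable_ltr_set; apply: measurable_enorm_sub => //.
  move=> y /= xy k; rewrite /= in_itv/=.
  have := coord_le_enorm (row_of_tuple x - row_of_tuple y) k.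
  rewrite !mxE => h; have := le_lt_trans h xy; rewrite ltr_norml => /andP[h1 h2].
  by apply/andP; split; lra.
rewrite (dX i _ mB).
apply: (@le_trans _ _ (\int[lambda]_(y in B) (K ^+ 2)%:E)%E).
  apply: ge0_le_integral => //.
  - by move=> y _; rewrite lee_fin sqr_ge0.
  - by apply: measurable_funTS; apply/measurable_EFinP; exact: measurable_funX.
  - move=> y _; rewrite lee_fin; have /andP[f0 fk] := fK y.
    by apply: lerXn2r => //; rewrite nnegrE// (le_trans f0).
rewrite integral_cst// [leRHS]EFinM; apply: lee_wpmul2l.
  by rewrite lee_fin sqr_ge0.
rewrite [leLHS]lebesgue_tuple_box//.
under eq_bigr do rewrite lebesgue_measure_symm_itv//.
by rewrite prodEFin prodr_const card_ord lee_fin mulr_natl mulr2n.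
Qed.

(** By independence the probability is the mean, over the position of the i-th
    point, of the probability of a ball around it. *)
Lemma pair_probability X f (K r : R) i j :
  measurable_fun [set: d.-tuple R] f -> (forall y, 0 <= f y <= K) -> 0 <= r ->
  root_density lambda f X -> mutually_independent X -> i != j ->
  (P [set w | (enorm (row_of_tuple (X i w) - row_of_tuple (X j w)) < r)%R]
    <= (K ^+ 2 * (2 * r) ^+ d)%:E)%E.
Proof.
move=> mf fK r0 dX iX ij.
pose phi (w : T) := (X i w, X j w).
have mphi : measurable_fun setT phi by exact: measurable_fun_pair.
pose D : set (d.-tuple R * d.-tuple R) :=
  [set z | enorm (row_of_tuple z.1 - row_of_tuple z.2) < r].
have mD : measurable D.
  by apply: measurable_ltr_set; apply: measurable_enorm_sub.
have := @product_measure_unique _ _ _ _ _ (distribution P (X i))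
  (distribution P (X j)) (pushforward P phi).
move=> /(_ mphi) h.
have -> : P [set w | (enorm (row_of_tuple (X i w) - row_of_tuple (X j w)) < r)%R] =
   (distribution P (X i) \x distribution P (X j))%E D.
  rewrite h// => A B mA mB.
  have mAB k : measurable (if k == i then A else B) by case: ifP.
  have := iX [:: i; j] (fun k => if k == i then A else B).
  rewrite /= inE ij => /(_ erefl mAB).
  rewrite big_cons big_seq1 eqxx eq_sym (negbTE ij) => <-.
  congr (P _); apply/seteqP; split=> w /=.
    by move=> [Aw Bw] k /=; rewrite !inE => /orP[]/eqP ->;
      rewrite ?eqxx ?[j == i]eq_sym ?(negbTE ij).
  move=> H; split.
    by have := H i; rewrite /= !inE eqxx => /(_ erefl).
  by have := H j; rewrite /= !inE eqxx orbT eq_sym (negbTE ij) => /(_ erefl).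
rewrite /product_measure1 /=.
apply: (@le_trans _ _ (\int[distribution P (X i)]_x (K ^+ 2 * (2 * r) ^+ d)%:E)%E).
  apply: ge0_le_integral => //.
  - exact: measurable_fun_xsection.
  - move=> x _ /=.
    have -> : xsection D x = [set y | (enorm (row_of_tuple x - row_of_tuple y) < r)%R].
      by apply/seteqP; split=> y; rewrite /xsection /= in_setE.
    exact: (ball_probability j x mf fK r0 dX).
by rewrite integral_cst// [X in (_ * X)%E]probability_setT mule1.
Qed.

End close_pairs.

Section typical_size.
Context {R : realType} {disp} {T : measurableType disp} (P : probability T R)
  {d : nat}.
Implicit Types (X : nat -> {RV P >-> d.-tuple R}) (f : d.-tuple R -> R).
Local Notation lambda := (lebesgue_tuple R d).

Definition close_event X (r : R) (i j : nat) : set T :=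
  [set w | enorm (row_of_tuple (X i w) - row_of_tuple (X j w)) < r].

Lemma measurable_close_event X r i j : measurable (close_event X r i j).
Proof. by apply: measurable_ltr_set; apply: measurable_enorm_sub. Qed.

Definition close_count X r n (w : T) : R :=
  \sum_(i < n) \sum_(j < n | j != i) \1_(close_event X r i j) w.

Lemma measurable_close_count X r n : measurable_fun [set: T] (close_count X r n).
Proof.
apply: measurable_sum => i; under eq_fun do rewrite big_mkcond.
apply: measurable_sum => j; case: (j != i) => //.
by apply: measurable_indic; exact: measurable_close_event.
Qed.

(** A point that is not r-isolated contributes at least 1 to the count. *)
Lemma close_count_isolated X r n w :
  n%:R <= close_count X r n w + #|r_isolated (points_of (sample X n w)) r|%:R.
Proof.
rewrite -[X in _ <= _ + X%:R]sum1_card natr_sum big_mkcond/= /close_count -big_split/=.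
rewrite -[X in X%:R](card_ord n) -sum1_card natr_sum.
apply: ler_sum => i _.
have S0 (Q : pred 'I_n) : 0 <= \sum_(j < n | Q j) \1_(close_event X r i j) w :> R.
  by apply: sumr_ge0 => j _; rewrite indicE.
case: ifPn => [_|]; first by rewrite lerDr.
rewrite unfold_in /r_isolated negb_forall => /existsP[j].
rewrite negb_imply -ltNge => /andP[ji close].
have cl : close_event X r i j w by move: close; rewrite /points_of !tnth_mktuple.
rewrite addr0 (bigD1 j)//= indicE mem_set// lerDl.
by apply: sumr_ge0 => l _; rewrite indicE.
Qed.

(** Markov's inequality: the mean number of ordered close pairs is at most n^2
    times the bound of pair_probability. *)
Lemma close_count_probability X f (K r : R) n :
  measurable_fun [set: d.-tuple R] f -> (forall y, 0 <= f y <= K) -> 0 <= r ->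
  root_density lambda f X -> mutually_independent X -> (0 < n)%N ->
  (P [set w | n%:R / 2 <= close_count X r n w]%R
    <= (2 * n%:R * (K ^+ 2 * (2 * r) ^+ d))%:E)%E.
Proof.
move=> mf fK r0 dX iX n0.
set q := K ^+ 2 * _.
have q0 : 0 <= q by rewrite mulr_ge0 ?sqr_ge0// exprn_ge0// mulr_ge0.
have mC := measurable_close_count X r n.
set A := [set w | _]%R.
have mA : measurable A.
  rewrite (_ : A = ~` [set w | close_count X r n w < n%:R / 2]).
    by apply: measurableC; exact: measurable_ltr_set.
  by apply/seteqP; split=> w /=; rewrite /A /= leNgt => /negP.
have C0 w : 0 <= close_count X r n w.
  by apply: sumr_ge0 => i _; apply: sumr_ge0 => j _; rewrite indicE.
have h1 : ((n%:R / 2)%:E * P A <= \int[P]_w (close_count X r n w)%:E)%E.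
  have mI : measurable_fun [set: T] (fun w => (\1_A w : R)%:E).
    by apply/measurable_EFinP; exact: measurable_indic.
  have I0 w : setT w -> (0 <= (\1_A w : R)%:E)%E by rewrite lee_fin indicE.
  have n20 : (0 <= (n%:R / 2 : R)%:E)%E by rewrite lee_fin divr_ge0.
  rewrite -[in P A](setIT A) -(integral_indic P measurableT mA) -ge0_integralZl//.
  apply: ge0_le_integral => //.
  - by apply: measurable_funeM; apply/measurable_EFinP; exact: measurable_indic.
  - exact/measurable_EFinP.
  move=> w _; rewrite -EFinM lee_fin indicE.
  by case: (boolP (w \in A)) => [/set_mem|_]; rewrite ?mulr1 ?mulr0.
have h2 : (\int[P]_w (close_count X r n w)%:E <= (n%:R ^+ 2 * q)%:E)%E.
  rewrite /close_count; under eq_integral do rewrite -sumEFin.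
  rewrite ge0_integral_sum//; last 2 first.
  - move=> i; apply/measurable_EFinP; under eq_fun do rewrite big_mkcond.
    apply: measurable_sum => j; case: (j != i) => //.
    by apply: measurable_indic; exact: measurable_close_event.
  - by move=> i w _; rewrite lee_fin; apply: sumr_ge0 => j _; rewrite indicE.
  apply: (@le_trans _ _ (\sum_(i < n) (n%:R * q)%:E)%E); last first.
    by rewrite sumEFin lee_fin sumr_const card_ord -[leLHS]mulr_natl expr2 mulrA.
  apply: lee_sum => i _; under eq_integral do rewrite -sumEFin big_mkcond/=.
  rewrite ge0_integral_sum//; last 2 first.
  - move=> j; case: (j != i) => //; apply/measurable_EFinP.
    by apply: measurable_indic; exact: measurable_close_event.
  - by move=> j w _; case: ifP => // _; rewrite lee_fin indicE.
  apply: (@le_trans _ _ (\sum_(j < n) q%:E)%E); last first.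
    by rewrite sumEFin lee_fin sumr_const card_ord -[leLHS]mulr_natl.
  apply: lee_sum => j _; case: (boolP (j != i)) => ij; last first.
    by rewrite integral0_eq// lee_fin.
  rewrite integral_indic ?setIT//; last exact: measurable_close_event.
  apply: (pair_probability mf fK r0 dX iX).
  by rewrite eq_sym.
have n0' : 0 < n%:R / 2 :> R by rewrite divr_gt0// ltr0n.
rewrite -(@lee_pmul2l _ (n%:R / 2)%:E)//.
apply: (le_trans h1); apply: (le_trans h2).
by rewrite -EFinM lee_fin le_eqVlt; apply/orP; left; apply/eqP; field.
Qed.

(** If F is small then fewer than n/2 points are r-isolated, so at least n/2
    ordered pairs are close. *)
Lemma small_spread_probability X f (K r k : R) n F :
  measurable_fun [set: d.-tuple R] f -> (forall y, 0 <= f y <= K) -> 0 < r ->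
  root_density lambda f X -> mutually_independent X -> (0 < n)%N ->
  @spread_functional R d n F k ->
  (P [set w | (k * F (points_of (sample X n w)) < r * (n%:R / 2))%R]
    <= (2 * n%:R * (K ^+ 2 * (2 * r) ^+ d))%:E)%E.
Proof.
move=> mf fK r0 dX iX n0 [mF _ iF].
apply: le_trans (close_count_probability mf fK (ltW r0) dX iX n0).
apply: le_measure; rewrite ?inE//.
- apply: measurable_ltr_set; apply: measurable_funM => //.
  by apply: (measurableT_comp mF); exact: measurable_sample.
- rewrite (_ : [set w | _] = ~` [set w | close_count X r n w < n%:R / 2]).
    apply: measurableC; apply: measurable_ltr_set; exact: measurable_close_count.
  by apply/seteqP; split=> w /=; rewrite leNgt => /negP.
- move=> w /= h; have := le_lt_trans (iF (points_of (sample X n w)) r (ltW r0)) h.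
  rewrite ltr_pM2l// => h2; have := close_count_isolated X r n w; lra.
Qed.

End typical_size.

(** * Lower bound on fluctuations *)

Section fluctuations.
Context {R : realType} {disp} {T : measurableType disp} (P : probability T R)
  {d : nat}.
Implicit Types (X : nat -> {RV P >-> d.-tuple R}) (f : d.-tuple R -> R).
Local Notation lambda := (lebesgue_tuple R d).

Lemma bernoulli_ineq (x : R) n : 0 <= x <= 1 -> 1 - n%:R * x <= (1 - x) ^+ n.
Proof.
move=> /andP[x0 x1]; elim: n => [|n IH]; first by rewrite expr0 mul0r subr0.
rewrite exprS -natr1.
have h0 : 0 <= 1 - x by rewrite subr_ge0.
have : 0 <= n%:R :> R by [].
by have := ler_wpM2l h0 IH; nra.
Qed.

(** With s = n^(1/2) and v = n^(-1/d), all the powers of n below become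
    polynomial in s and v; the last identity is
    (d - 2) / (2 d) + 1/2 = 1 - 1/d. *)
Lemma powR_exponents (n : nat) : (0 < d)%N -> (0 < n)%N ->
  let s := n%:R `^ 2^-1 : R in let v := n%:R `^ (- d%:R^-1) : R in
  [/\ 0 < s, s ^+ 2 = n%:R, 0 < v, v ^+ d = n%:R^-1 &
      n%:R `^ ((d%:R - 2) / (2 * d%:R)) * s = n%:R * v].
Proof.
move=> d0 n0 s v; have N0 : 0 < n%:R :> R by rewrite ltr0n.
have D0 : d%:R != 0 :> R by rewrite pnatr_eq0 -lt0n.
split; rewrite ?powR_gt0//.
- by rewrite -powR_mulrn ?powR_ge0// -powRrM mulVf// powRr1// ltW.
- by rewrite -powR_mulrn ?powR_ge0// -powRrM mulNr mulVf// powR_inv1// ltW.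
- rewrite -[X in X * v]powRr1 ?(ltW N0)// -!powRD; last 2 first.
  + by rewrite (gt_eqF N0) implybT.
  + by rewrite (gt_eqF N0) implybT.
  congr (_ `^ _); field.
  by rewrite D0.
Qed.

(** Suppose that the interval has probability more than 15/16 for the sample.
    When F >= m, dilation moves F by at least (1 - t) m > b - a, so the dilated
    sample meets the interval with probability at most 1/16 + 1/16.  With the
    weights 1/3 and 4, affinity_tensor bounds 2 (1 - e/2)^n by
    1/3 + 3/8 + 1/4 + 1/4 < 3/2, while Bernoulli's inequality makes it at least
    3/2. *)
Lemma spread_anticoncentration X f (C a b t m k : R) n F :
  measurable_fun [set: d.-tuple R] f -> (forall x, 0 <= f x) ->
  mutually_independent X -> root_density lambda f X ->
  @spread_functional R d n F k ->
  0 < t -> t <= 1 -> b - a < (1 - t) * m ->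
  0 <= C -> C * (1 - t) ^+ 2 <= 1 -> 2 * n%:R * (C * (1 - t) ^+ 2) <= 1 ->
  (\int[lambda]_x ((dilated f t x - f x) ^+ 2)%:E <= (C * (1 - t) ^+ 2)%:E)%E ->
  (P [set w | (F (points_of (sample X n w)) < m)%R] <= (16^-1)%:E)%E ->
  0 <= m ->
  (P [set w | (a <= F (points_of (sample X n w)) <= b)%R] <= (1 - 16^-1)%:E)%E.
Proof.
move=> mf f0 iX dX [mF hF _] t0 t1 bam C0 Ce1 nCe Ihell smallP m0.
set e := C * _ in Ce1 nCe Ihell.
have e0 : 0 <= e by rewrite mulr_ge0// sqr_ge0.
pose Y := scaled_seq t^-1 X.
have iY : mutually_independent Y by exact: scaled_independent.
have dY := scaled_root_density t0 mf dX.
pose A : set (n.-tuple (d.-tuple R)) := [set s | a <= F (points_of s) <= b].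
have mA : measurable A.
  rewrite (_ : A = ~` [set s | F (points_of s) < a] `&` ~` [set s | - F (points_of s) < - b]).
    apply: measurableI; apply: measurableC; apply: measurable_ltr_set => //.
    exact: measurable_funN.
  apply/seteqP; split=> s; rewrite /A/=.
    by move=> /andP[h1 h2]; split; apply/negP; rewrite -leNgt// lerN2.
  by move=> [/negP h1 /negP h2]; move: h1 h2; rewrite -!leNgt lerN2 => -> ->.
have mAC := measurableC mA.
have g0 x : 0 <= dilated f t x by rewrite mulr_ge0// sqrtr_ge0.
have r0 : 0 <= 1 - e / 2 by lra.
have := affinity_tensor r0 mf (measurable_dilated t mf) f0 g0
  (root_affinity t0 mf f0 dX Ihell) iX iY dX dY mA.
have i3 : 0 < 3^-1 :> R by rewrite invr_gt0.
move=> /(_ 3^-1 4 i3 (ltr0n R 4)).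
have mX (Z : nat -> {RV P >-> d.-tuple R}) (B : set (n.-tuple (d.-tuple R))) :
  measurable B -> measurable (sample Z n @^-1` B).
  exact: measurable_preimage_sample.
have PE (B : set T) : measurable B ->
    exists x : R, P B = x%:E /\ 0 <= x <= 1.
  move=> mB; exists (fine (P B)); rewrite fineK ?fin_num_measure//; split=> //.
  by rewrite -!lee_fin fineK ?fin_num_measure// measure_ge0 probability_le1.
have XCE : P (sample X n @^-1` ~` A) = (1 - P (sample X n @^-1` A))%E.
  by rewrite -probability_setC//; exact: mX.
have YA : (P (sample Y n @^-1` A) <=
    P [set w | (F (points_of (sample X n w)) < m)%R] + P (sample X n @^-1` ~` A))%E.
  have mS : measurable [set w | F (points_of (sample X n w)) < m].
    apply: measurable_ltr_set.
    by apply: (measurableT_comp mF); exact: measurable_sample.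
  apply: le_trans (measureU2 _ mS (mX X _ mAC)).
  apply: le_measure; rewrite ?inE//; [exact: mX| |].
    by apply: measurableU => //; exact: mX.
  move=> w /= Yw; case: (pselect (A (sample X n w))) => Xw; last by right.
  left; move: Xw Yw; rewrite /A /=.
  have -> : points_of (sample Y n w) = (fun i => t^-1 *: points_of (sample X n w) i).
    by apply/funext => i; apply/rowP => j; rewrite !mxE !tnth_mktuple.
  rewrite hF ?invr_gt0//; set y := F _ => /andP[ay yb] /andP[aty tyb].
  rewrite ltNge; apply/negP => my.
  have y0 : 0 <= y := le_trans m0 my.
  have : (t^-1 - 1) * y <= b - a by rewrite mulrBl mul1r lerB.
  have tV : 1 - t <= t^-1 - 1.
    have tt : t * t^-1 = 1 by rewrite divff// lt0r_neq0.
    have ti : 0 < t^-1 by rewrite invr_gt0.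
    by nra.
  move=> h; have := ler_wpM2r y0 tV.
  have := ler_wpM2l (_ : 0 <= 1 - t) my; rewrite subr_ge0 => /(_ t1).
  by lra.
have -> : [set w | a <= F (points_of (sample X n w)) <= b] = sample X n @^-1` A by [].
have [xA [xAE /andP[xA0 xA1]]] := PE _ (mX X _ mA).
have [xC [xCE /andP[xC0 xC1]]] := PE _ (mX X _ mAC).
have [yA [yAE /andP[yA0 yA1]]] := PE _ (mX Y _ mA).
have [yC [yCE /andP[yC0 yC1]]] := PE _ (mX Y _ mAC).
have mS : measurable [set w | F (points_of (sample X n w)) < m].
  apply: measurable_ltr_set.
  by apply: (measurableT_comp mF); exact: measurable_sample.
have [q [qE /andP[q0 q1]]] := PE _ mS.
move: XCE YA smallP; rewrite xAE xCE yAE yCE qE -!EFinM -!EFinD !lee_fin invrK.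
move=> -[xCxA] yAle qle.
have := @bernoulli_ineq (e / 2) n.
rewrite divr_ge0// ler_pdivrMr// mul1r => /(_ _) h; have {}h := h (le_trans Ce1 (ler1n _ 2)).
move=> aff; rewrite leNgt; apply/negP => hx.
by move: h aff; set z := _ ^+ n; move=> h aff; lra.
Qed.

(** The parameters of the argument.  The radius is r = (q / 2) n^(-1/d), with q
    chosen so that the probability of an atypically small F, which is at most
    2 K^2 q^d, is at most 1/16.  The dilation is t = 1 - al / sqrt n, with al
    chosen so that n times the squared Hellinger distance is at most
    C al^2 <= 1/2. *)
Lemma spread_fluctuations X p (I : pred nat)
    (F : forall n, ('I_n -> 'rV[R]_d) -> R) (k : R) :
  (0 < d)%N -> (exists f, regular_root p f) ->
  mutually_independent X -> (forall i, has_density (X i) p) -> 0 < k ->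
  (forall n, (1 < n)%N -> I n -> spread_functional (@F n) k) ->
  fluctuations_at_least P I (fun n w => F n (fun i => row_of_tuple (X i w)))
    (fun n => n%:R `^ ((d%:R - 2) / (2 * d%:R))).
Proof.
move=> d0 [f [mf f0 [K0 fK0] fE [C [C0 hC]]]] iX Xdens k0 hF.
have dX : root_density lambda f X by move=> i A mA; rewrite Xdens// fE.
pose K := Num.max K0 1.
have K1 : 1 <= K by rewrite le_max lexx orbT.
have fK y : 0 <= f y <= K by rewrite f0/= le_max fK0.
pose q := (32 * K ^+ 2)^-1.
have K2 : 1 <= K ^+ 2 by rewrite exprn_ege1.
have q0 : 0 < q by rewrite invr_gt0; lra.
have q1 : q <= 1 by rewrite invf_le1; lra.
have qK : q * (32 * K ^+ 2) = 1 by rewrite mulVf//; apply: lt0r_neq0; lra.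
pose al := (2 * (1 + C))^-1.
have al0 : 0 < al by rewrite invr_gt0; lra.
have alC : al * (2 * (1 + C)) = 1 by rewrite mulVf//; apply: lt0r_neq0; lra.
have al2 : al <= 2^-1 by nra.
have alC2 : C * al ^+ 2 <= 2^-1 by nra.
exists (al * q / (16 * k)), (16^-1); split.
- by rewrite divr_gt0 ?mulr_gt0.
- by [].
exists 2%N => // n /= n2 In a b ab.
have n0 : (0 < n)%N by exact: leq_trans n2.
have [] := @powR_exponents n d0 n0.
set s := n%:R `^ 2^-1; set v := n%:R `^ (- _).
set dl := n%:R `^ ((d%:R - 2) / _).
move=> s0 s2 v0 vd dsv bac.
have N1 : 1 <= n%:R :> R by rewrite ler1n.
have s1 : 1 <= s by rewrite -(@ler_pXn2r _ 2)// ?nnegrE ?(ltW s0)// expr1n s2.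
have sS := hF _ n2 In.
pose t := 1 - al / s.
have als : al / s <= 2^-1 by rewrite ler_pdivrMr//; nra.
have als0 : 0 < al / s by rewrite divr_gt0.
have t2 : 2^-1 <= t by rewrite /t; lra.
have t1 : t <= 1 by rewrite /t; lra.
have t0 : 0 < t by rewrite /t; lra.
have tE : 1 - t = al / s by rewrite /t; ring.
have ss : s * s^-1 = 1 by rewrite divff// lt0r_neq0.
have Cn : n%:R * (C * (1 - t) ^+ 2) = C * al ^+ 2.
  rewrite tE -s2; field; exact: lt0r_neq0.
have ptsE w : (fun i : 'I_n => row_of_tuple (X i w)) = points_of (sample X n w).
  by apply/funext => i; rewrite /points_of tnth_mktuple.
under eq_set do rewrite ptsE.
(* n / 2 isolated points, each worth the radius, bound k F from below *)
pose m := q / 4 * n%:R * v / k.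
have m0 : 0 < m.
  by rewrite divr_gt0// !mulr_gt0// ?invr_gt0// ltr0n.
have Ce0 : 0 <= C * (1 - t) ^+ 2 by rewrite mulr_ge0// sqr_ge0.
apply: (@spread_anticoncentration X f C a b t m k n) => //.
- apply: (le_lt_trans bac).
  rewrite (_ : al * q / (16 * k) * dl = (1 - t) * (m / 4)).
    by rewrite tE ltr_pM2l//; lra.
  rewrite tE /m (_ : dl = n%:R * v / s); last by rewrite -dsv mulfK// lt0r_neq0.
  by field; rewrite !lt0r_neq0.
- by apply: le_trans (_ : n%:R * (C * (1 - t) ^+ 2) <= _); [rewrite ler_peMl|rewrite Cn; lra].
- by rewrite -mulrA Cn; lra.
- by apply: hC; rewrite t2.
- have := small_spread_probability mf fK (_ : 0 < q / 2 * v) dX iX n0 sS.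
  rewrite mulr_gt0 ?divr_gt0// => /(_ erefl).
  have -> : [set w | k * F n (points_of (sample X n w)) < q / 2 * v * (n%:R / 2)] =
      [set w | F n (points_of (sample X n w)) < m].
    apply/seteqP; split=> w /=; rewrite /m ltr_pdivlMr// mulrC;
      by rewrite (_ : q / 4 * n%:R * v = q / 2 * v * (n%:R / 2)); [|field].
  move=> /le_trans; apply; rewrite lee_fin.
  have qd : q ^+ d <= q.
    by rewrite -[X in _ <= X]expr1; apply: ler_wiXn2l => //; rewrite ltW.
  rewrite (_ : 2 * (q / 2 * v) = q * v); last by field.
  rewrite exprMn vd (_ : 2 * n%:R * _ = 2 * K ^+ 2 * q ^+ d).
    by have := ler_wpM2l (_ : 0 <= 2 * K ^+ 2) qd; rewrite mulr_ge0 ?sqr_ge0// => /(_ erefl); lra.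
  by field; rewrite lt0r_neq0// ltr0n.
- exact: ltW.
Qed.

End fluctuations.

(** * Tours and minimal matchings of a random sample *)

Theorem corollary2p2 (R : realType) (disp : measure_display)
    (T : measurableType disp) (P : probability T R)
    (d : nat) (hd : (2 <= d)%N)
    (p : 'rV[R]_d -> R) (hp : class_P p \/ class_Pplus p)
    (X : nat -> {RV P >-> d.-tuple R})
    (Xindep : mutually_independent X)
    (Xdens : forall i, has_density (X i) p) :
  let delta (n : nat) : R := n%:R `^ ((d%:R - 2) / (2 * d%:R)) in
  let points (n : nat) (w : T) (i : 'I_n) := row_of_tuple (X i w) in
  let L (n : nat) (w : T) : R := tsp_length (points n w) in
  let M (n : nat) (w : T) : R := min_matching_length (points n w) in
  fluctuations_at_least P predT L delta /\
  fluctuations_at_least P (fun n => ~~ odd n) M delta.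
Proof.
move=> delta points L M.
have d0 : (0 < d)%N by exact: leq_trans hd.
have rp : exists f, regular_root p f.
  by case: hp => [/class_P_regular_root|/class_Pplus_regular_root].
split.
  apply: (spread_fluctuations (F := @tsp_length R d) (k := 1) d0 rp) => //.
  by move=> n n1 _; exact: tsp_spread.
apply: (spread_fluctuations (F := @min_matching_length R d) (k := 2) d0 rp) => //.
by move=> n n1 en; exact: min_matching_spread.
Qed.
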